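(* There exist absolute constants $C,c>0$ such that the following holds. Let $\Phi:\mathbb{R}^d\to\mathbb{R}$ be a random ReLU network with $L$ hidden layers of width $N$ (as described in the context). Assume $$N\ge C\cdot dL,\quad N\ge C\cdot d\cdot L^4\cdot\ln^2(N/d)\cdot\ln^2(N/(dL)),\quad\text{and}\quad d\ge C.$$ Then, with probability at least $1-\exp(-c\cdot d)$, $$\mathrm{Lip}_p(\Phi)\ge c\cdot d^{1-1/p}\quad\text{for all }p\in[2,\infty].$$
   Context: Absolute constants do not depend on any parameter ($d,N,L,p$, the bias distributions, etc.); $1/\infty=0$. ReLU network with $L$ hidden layers of width $N$ ($d,N,L\in\mathbb{N}$): $\Phi=V^{(L)}\circ\mathrm{ReLU}\circ V^{(L-1)}\circ\dots\circ\mathrm{ReLU}\circ V^{(0)}:\mathbb{R}^d\to\mathbb{R}$, where $\mathrm{ReLU}(t)=\max\{0,t\}$ acts componentwise and $V^{(\ell)}(x)=W^{(\ell)}x+b^{(\ell)}$, with weights $W^{(0)}\in\mathbb{R}^{N\times d}$, $W^{(1)},\dots,W^{(L-1)}\in\mathbb{R}^{N\times N}$, $W^{(L)}\in\mathbb{R}^{1\times N}$ and biases $b^{(0)},\dots,b^{(L-1)}\in\mathbb{R}^N$, $b^{(L)}\in\mathbb{R}$. Random network: the entries of $W^{(\ell)}$, $0\le\ell<L$, are $\mathcal{N}(0,2/N)$, those of $W^{(L)}$ are $\mathcal{N}(0,1)$, all weight entries jointly independent; the entries of the biases are drawn independently from arbitrary (possibly different) real-valued distributions and are jointly independent of the weights.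 Lipschitz constant: $\mathrm{Lip}_p(\Phi)=\sup_{x\ne y}|\Phi(x)-\Phi(y)|/\|x-y\|_p$. *)

(* Defs.v *)
From HB Require Import structures.
From mathcomp Require Import all_boot all_order all_algebra.
From mathcomp Require Import all_classical all_reals all_analysis.

Set Implicit Arguments.
Unset Strict Implicit.
Unset Printing Implicit Defensive.

Import Order.TTheory GRing.Theory Num.Theory.
Import numFieldNormedType.Exports.

Local Open Scope classical_set_scope.
Local Open Scope ring_scope.

(* Parameters of a network with L >= 1 hidden layers of width N. The l-th
   inner layer, l : 'I_L.-1, is the affine map V^(l+1). For L = 0 the type is
   still inhabited, by networks with one hidden layer, so users must assume
   0 < L. *)
Record relu_params (R : realType) (d N L : nat) := ReluParams {
  W_first : 'M[R]_(N, d);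
  b_first : 'cV[R]_N;
  W_inner : 'I_L.-1 -> 'M[R]_N;
  b_inner : 'I_L.-1 -> 'cV[R]_N;
  W_last : 'rV[R]_N;
  b_last : 'cV[R]_1 }.

Definition relu (R : realType) (t : R) : R := Num.max 0 t.

Definition relu_layer (R : realType) (m n : nat) (W : 'M[R]_(n, m))
    (b : 'cV[R]_n) (x : 'cV[R]_m) : 'cV[R]_n :=
  map_mx (@relu R) (W *m x + b).

Definition relu_net (R : realType) (d N L : nat) (theta : relu_params R d N L)
    (x : 'cV[R]_d) : R :=
  let h := foldl (fun y l => relu_layer (W_inner theta l) (b_inner theta l) y)
             (relu_layer (W_first theta) (b_first theta) x) (enum 'I_L.-1) in
  (W_last theta *m h + b_last theta) ord0 ord0.

(* Meant for 1 <= p <= +oo. The junk value p = -oo also falls in the last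
   branch. *)
Definition lp_norm (R : realType) (d : nat) (p : \bar R) (x : 'cV[R]_d) : R :=
  if p is r%:E then (\sum_i `|x i ord0| `^ r) `^ r^-1
  else \big[Num.max/0]_i `|x i ord0|.

Definition lipschitz_const (R : realType) (d : nat) (p : \bar R)
    (f : 'cV[R]_d -> R) : \bar R :=
  ereal_sup [set (`|f xy.1 - f xy.2| / lp_norm p (xy.1 - xy.2))%:E
            | xy in [set xy : 'cV[R]_d * 'cV[R]_d | xy.1 != xy.2]].

Definition mutually_independent (disp : measure_display)
    (T : measurableType disp) (R : realType) (P : probability T R)
    (I : finType) (X : I -> {RV P >-> R}) : Prop :=
  forall (J : {set I}) (A : I -> set R), (forall i, measurable (A i)) ->
    P (\bigcap_(i in [set` J]) (X i @^-1` A i)) =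
    (\prod_(i in J) P (X i @^-1` A i))%E.

Definition has_normal_law (disp : measure_display) (T : measurableType disp)
    (R : realType) (P : probability T R) (m v : R) (X : {RV P >-> R}) : Prop :=
  forall A : set R, measurable A ->
    distribution P X A = normal_prob m (Num.sqrt v) A.

(* Scalar parameters: entries of the first weight matrix, of the inner weight
   matrices, of the last one; then of the hidden biases, and the last bias. *)
Definition weight_index (d N L : nat) : finType :=
  ('I_N * 'I_d + ('I_L.-1 * 'I_N * 'I_N + 'I_N))%type.
Definition bias_index (N L : nat) : finType :=
  ('I_N + ('I_L.-1 * 'I_N + unit))%type.
Definition param_index (d N L : nat) : finType :=
  (weight_index d N L + bias_index N L)%type.

Definition params_of (R : realType) (d N L : nat)
    (z : param_index d N L -> R) : relu_params R d N L :=
  let w (i : weight_index d N L) : R := z (inl i) in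
  let b (i : bias_index N L) : R := z (inr i) in
  {| W_first := \matrix_(i, j) w (inl (i, j));
     b_first := \col_i b (inl i);
     W_inner := fun l => \matrix_(i, j) w (inr (inl (l, i, j)));
     b_inner := fun l => \col_i b (inr (inl (l, i)));
     W_last := \row_j w (inr (inr j));
     b_last := \col__ b (inr (inr tt)) |}.

(* No condition on the laws of the biases: they are arbitrary. *)
Definition random_params (disp : measure_display) (T : measurableType disp)
    (R : realType) (P : probability T R) (d N L : nat)
    (Z : param_index d N L -> {RV P >-> R}) : Prop :=
  [/\ mutually_independent Z,
      forall ij : 'I_N * 'I_d,
        has_normal_law 0 (2 / N%:R) (Z (inl (inl ij))),
      forall lij : 'I_L.-1 * 'I_N * 'I_N,
        has_normal_law 0 (2 / N%:R) (Z (inl (inr (inl lij)))) &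
      forall j : 'I_N, has_normal_law 0 1 (Z (inl (inr (inr j))))].

Definition random_relu_net (disp : measure_display) (T : measurableType disp)
    (R : realType) (P : probability T R) (d N L : nat)
    (Z : param_index d N L -> {RV P >-> R}) (t : T) : 'cV[R]_d -> R :=
  relu_net (params_of (fun k => Z k t)).

Definition with_probability_ge (disp : measure_display)
    (T : measurableType disp) (R : realType) (P : probability T R)
    (E : set T) (q : R) : Prop :=
  measurable E /\ (q%:E <= P E)%E.

(* Main.v *)
Require Import Defs.
From HB Require Import structures.
From mathcomp Require Import all_boot all_order all_algebra.
From mathcomp Require Import all_classical all_reals all_analysis.
From mathcomp Require Import measurable_realfun ring lra.

Set Implicit Arguments.
Unset Strict Implicit.
Unset Printing Implicit Defensive.

Import Order.TTheory GRing.Theory Num.Theory.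
Import numFieldNormedType.Exports.

Local Open Scope classical_set_scope.
Local Open Scope ring_scope.

(* Far out on the ray t e_0 the biases cannot change the activation pattern as
   soon as no pre-activation of the bias-free network vanishes at e_0, so the
   network is eventually affine near t e_0, with the bias-free gradient g at e_0
   as linear part. Hence Lip_oo >= ||g||_1, and p = +oo implies every other p.

   To bound ||g||_1 from below, integrate the Gaussian weights one layer at a
   time. Given the input x of a layer, an orthogonal change of the columns of its
   matrix W supported on supp x turns W x into a multiple of a single column.
   That column alone fixes the activations, hence the vector b back-propagated
   to this layer; the other columns are independent of b, so on supp x the
   squared norm of W^T b is at least (2/N) |b|^2 times a chi-square with
   |supp x| - 1 degrees of freedom, where |supp x| is close to N/2. A relative
   loss 1/(2L) per layer is affordable and fails with probability exp(-c N/L^2);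
   since N >= C d L^4, a union bound over the layers suffices. In the first layer
   the base point e_0 selects the first column, and the other d - 1 coordinates of
   g are independent centered Gaussians of variance at least 1/2. *)

(** * Gaussian integrals on the line and in the plane *)

(** The obstacle is that the back-propagated vector b depends, through the activation pattern, on
    the very matrix W whose transpose is applied to it, and that the rotation removing this
    dependence depends on the input x of the layer. So x may be taken deterministic, biases of any
    law simply stay frozen, and a block can be integrated in whichever order is convenient.
    Independence of the random parameters serves to replace them by such integrals.

    Only supp x counts because the ReLU in front of the layer discards the other entries of W^T b.
    On the roughly N/2 entries that are left, the variance 2/N preserves the squared norm on
    average, so a layer loses only its fluctuation.

    Orthogonal changes are composed of rotations of two columns, and these of shears, so translation
    invariance of Lebesgue measure and Tonelli's theorem suffice. *)

Section gaussian.
Variable R : realType.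
Local Notation mu := (@lebesgue_measure R).
Local Open Scope ereal_scope.
Import HBNNSimple.

(** Translation sends half-open intervals to intervals of the same length, and these determine
    Lebesgue measure. *)
Lemma integral_shift (f : R -> \bar R) (a : R) :
  measurable_fun [set: R] f -> (forall x, 0 <= f x) ->
  \int[mu]_x f (x + a)%R = \int[mu]_x f x.
Proof.
move=> mf f0.
pose phi : measurableTypeR R -> measurableTypeR R := fun x => (x + a)%R.
have mphi : measurable_fun setT phi by exact: measurable_funD.
have E := @ge0_integral_pushforward _ _ _ _ _ _ mphi mu setT f measurableT mf
  (fun y _ => f0 y).
rewrite preimage_setT in E.
rewrite (_ : (fun x => f (x + a)%R) = f \o phi)//.
rewrite -E.
apply: eq_measure_integral => A mA _.
apply/esym/lebesgue_measure_unique => // _ [[u v]] _ <-.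
transitivity (mu `](u - a)%R, (v - a)%R]%classic); last first.
  by congr (mu _); apply/seteqP; split => x /=; rewrite !in_itv/= /phi ltrBlDr lerBrDr.
rewrite !lebesgue_measure_itv/= !lte_fin ltrD2r -!EFinB.
by rewrite (_ : (v - a - (u - a) = v - u)%R)//; ring.
Qed.

Lemma integral_opp (f : R -> \bar R) :
  measurable_fun [set: R] f -> (forall x, 0 <= f x) ->
  \int[mu]_x f (- x)%R = \int[mu]_x f x.
Proof.
move=> mf f0.
pose phi : measurableTypeR R -> measurableTypeR R := -%R.
have mphi : measurable_fun setT phi by exact: oppr_measurable.
have E := @ge0_integral_pushforward _ _ _ _ _ _ mphi mu setT f measurableT mf
  (fun y _ => f0 y).
rewrite preimage_setT in E.
rewrite (_ : (fun x => f (- x)%R) = f \o phi)// -E.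
by apply: eq_measure_integral => A mA _; exact: lebesgue_measureN.
Qed.

Lemma integral2_shear2 (F : R * R -> \bar R) (a : R) :
  measurable_fun [set: R * R] F -> (forall p, 0 <= F p) ->
  \int[mu]_x \int[mu]_y F (x, y + a * x)%R = \int[mu]_x \int[mu]_y F (x, y).
Proof.
move=> mF F0; apply: eq_integral => x _.
rewrite (@integral_shift (fun y => F (x, y)))//.
by apply: measurableT_comp => //; exact: measurable_fun_pair.
Qed.

Lemma integral2_shear1 (F : R * R -> \bar R) (a : R) :
  measurable_fun [set: R * R] F -> (forall p, 0 <= F p) ->
  \int[mu]_x \int[mu]_y F (x + a * y, y)%R = \int[mu]_x \int[mu]_y F (x, y).
Proof.
move=> mF F0.
have mG : measurable_fun setT (fun p : R * R => F (p.1 + a * p.2, p.2)%R).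
  apply: measurableT_comp => //; apply: measurable_fun_pair => //.
  by apply: measurable_funD => //; exact: measurable_funM.
transitivity (\int[mu]_y \int[mu]_x F (x + a * y, y)%R).
  exact: (fubini_tonelli (m1 := mu) (m2 := mu) _ mG (fun p => F0 _)).
transitivity (\int[mu]_y \int[mu]_x F (x, y)); last first.
  exact/esym/(fubini_tonelli (m1 := mu) (m2 := mu) _ mF F0).
apply: eq_integral => y _.
rewrite (@integral_shift (fun x => F (x, y)))//.
by apply: measurableT_comp => //; exact: measurable_fun_pair.
Qed.

(* A rotation of angle other than pi is a product of three shears. *)
Lemma integral2_rotation (F : R * R -> \bar R) (c s : R) :
  (c ^+ 2 + s ^+ 2 = 1)%R -> (c != -1)%R ->
  measurable_fun [set: R * R] F -> (forall p, 0 <= F p) ->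
  \int[mu]_x \int[mu]_y F (c * x + s * y, c * y - s * x)%R =
  \int[mu]_x \int[mu]_y F (x, y).
Proof.
move=> cs c1 mF F0.
have c10 : (1 + c != 0)%R by rewrite addrC -(opprK 1%R) subr_eq0.
(* With c and s the cosine and sine of an angle, t is the tangent of half of it. The shears replace
   x by x + t y, then y by y - s x, then x by x + t y. *)
pose t := (s / (1 + c))%R.
have ts : (t * s = 1 - c)%R.
  rewrite /t mulrAC -expr2; apply: (mulIf c10); rewrite mulfVK//.
  by rewrite (_ : s ^+ 2 = 1 - c ^+ 2)%R; [ring|rewrite -cs; ring].
have tc : (t + t * c = s)%R by rewrite -{1}(mulr1 t) -mulrDr /t mulfVK.
have mshear1 (G : R * R -> \bar R) : measurable_fun [set: R * R] G ->
    measurable_fun setT (fun p : R * R => G (p.1 + t * p.2, p.2)%R).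
  move=> mG; apply: (measurableT_comp mG); apply: measurable_fun_pair => //.
  by apply: measurable_funD => //; exact: measurable_funM.
have mshear2 (G : R * R -> \bar R) : measurable_fun [set: R * R] G ->
    measurable_fun setT (fun p : R * R => G (p.1, p.2 + - s * p.1)%R).
  move=> mG; apply: (measurableT_comp mG); apply: measurable_fun_pair => //.
  by apply: measurable_funD => //; exact: measurable_funM.
transitivity (\int[mu]_x \int[mu]_y F (x + t * y, y)%R); last exact: integral2_shear1.
transitivity (\int[mu]_x \int[mu]_y
    F (x + t * (y + - s * x), y + - s * x)%R); last first.
  exact: (integral2_shear2 _ (mshear1 _ mF) (fun p => F0 _)).
rewrite -[RHS](integral2_shear1 t
  (mshear2 _ (mshear1 _ mF)) (fun p => F0 _))/=.
apply: eq_integral => x _; apply: eq_integral => y _; congr (F (_, _)).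
  rewrite (_ : x + t * y + t * (y + - s * (x + t * y)) =
    (1 - t * s) * x + (t + t * (1 - t * s)) * y)%R; last by ring.
  by rewrite ts subKr tc.
rewrite (_ : y + - s * (x + t * y) = (1 - t * s) * y - s * x)%R; last by ring.
by rewrite ts subKr.
Qed.

(** True by definition for indicators, hence for simple functions; monotone convergence does the
    rest. *)
Lemma ge0_integral_normal_prob (m s : R) (f : R -> \bar R) :
  measurable_fun [set: R] f -> (forall x, 0 <= f x) ->
  \int[normal_prob m s]_x f x = \int[mu]_x (f x * (normal_pdf m s x)%:E).
Proof.
move=> mf f0.
have mpdf : measurable_fun [set: R] (fun x : R => (normal_pdf m s x)%:E).
  by apply/measurable_EFinP; exact: measurable_normal_pdf.
have pdf0 x : 0 <= (normal_pdf m s x)%:E by rewrite lee_fin normal_pdf_ge0.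
have mf' : measurable_fun [set: measurableTypeR R] f by [].
pose f_ := nnsfun_approx measurableT mf'.
transitivity (lim (\int[normal_prob m s]_x (f_ n x)%:E @[n --> \oo])).
  rewrite -monotone_convergence//=.
  - apply: eq_integral => ? /[!inE] xD; apply/esym/cvg_lim => //=.
    exact: cvg_nnsfun_approx.
  - move=> n; apply/measurable_EFinP;
 exact: measurable_funP.
  - by move=> n ? _; rewrite lee_fin.
  - by move=> ? _ ? ? mn; rewrite lee_fin; exact/lefP/nd_nnsfun_approx.
rewrite [RHS](_ : _ = lim
    (\int[mu]_x ((f_ n x)%:E * (normal_pdf m s x)%:E) @[n --> \oo])); last first.
  rewrite -monotone_convergence//=.
  - apply: eq_integral => x /[!inE] xD; apply/esym/cvg_lim => //.
    apply: cvgeZr => //; exact: cvg_nnsfun_approx.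
  - move=> n; apply: emeasurable_funM => //.
    apply/measurable_EFinP; exact: measurable_funP.
  - by move=> n ? _; rewrite mule_ge0// lee_fin.
  - move=> x _ ? ? ?; apply: lee_wpmul2r => //.
    by rewrite lee_fin; exact/lefP/nd_nnsfun_approx.
apply: congr_lim; apply/funext => n /=.
under eq_integral do rewrite fimfunE -fsumEFin//.
under [RHS]eq_integral => x _.
  rewrite fimfunE -fsumEFin// ge0_mule_fsuml; last first.
    by move=> r; rewrite nnfun_muleindic_ge0.
  over.
rewrite !ge0_integral_fsum//; last 4 first.
- move=> r; apply: emeasurable_funM => //.
  exact/measurable_EFinP/measurable_funM.
- by move=> r x _; rewrite mule_ge0// nnfun_muleindic_ge0.
- by move=> r; exact/measurable_EFinP/measurable_funM.
- by move=> r x _; rewrite nnfun_muleindic_ge0.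
apply: eq_fsbigr => r _.
rewrite integralZl_indic_nnsfun// integral_indic// setIT.
have [r0|r0] := leP 0%R r; last first.
  rewrite preimage_nnfun0// measure0 mule0.
  rewrite integral0_eq// => x _.
  by rewrite indicE in_set0 mulr0 mul0e.
under eq_integral do rewrite EFinM -muleA.
rewrite ge0_integralZl//=; last 2 first.
- apply: emeasurable_funM => //.
  exact/measurable_EFinP/measurable_indic.
- by move=> x _; rewrite mule_ge0// lee_fin.
congr (_ * _); rewrite /normal_prob integral_mkcond.
apply: eq_integral => x _; rewrite patchE indicE.
by case: ifP; rewrite ?mul1e ?mul0e.
Qed.

(** The product of two centered densities with the same [sd] depends only on x^2 + y^2, so it can be
    absorbed into the function being rotated. *)
Lemma normal_prob_rotation (sd : R) (F : R * R -> \bar R) (c s : R) :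
  (sd != 0)%R -> (c ^+ 2 + s ^+ 2 = 1)%R -> (c != -1)%R ->
  measurable_fun [set: R * R] F -> (forall p, 0 <= F p) ->
  \int[normal_prob 0 sd]_x \int[normal_prob 0 sd]_y
    F (c * x + s * y, c * y - s * x)%R =
  \int[normal_prob 0 sd]_x \int[normal_prob 0 sd]_y F (x, y).
Proof.
move=> sd0 cs c1 mF F0.
pose p2 (q : R * R) := ((normal_pdf 0 sd q.1)%:E * (normal_pdf 0 sd q.2)%:E).
have mpdf : measurable_fun [set: R] (fun x : R => (normal_pdf 0 sd x)%:E).
  by apply/measurable_EFinP; exact: measurable_normal_pdf.
have pdf0 x : 0 <= (normal_pdf 0 sd x)%:E by rewrite lee_fin normal_pdf_ge0.
have mp2 : measurable_fun setT p2.
  apply: emeasurable_funM.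
    exact: (measurableT_comp mpdf).
  exact: (measurableT_comp mpdf).
have key (G : R * R -> \bar R) : measurable_fun [set: R * R] G -> (forall p, 0 <= G p) ->
  \int[normal_prob 0 sd]_x \int[normal_prob 0 sd]_y G (x, y) =
  \int[mu]_x \int[mu]_y (G (x, y) * p2 (x, y)).
  move=> mG G0.
  rewrite ge0_integral_normal_prob; last 2 first.
  - exact: measurable_fun_fubini_tonelli_F.
  - by move=> x; exact: integral_ge0.
  apply: eq_integral => x _.
  have mGx : measurable_fun setT (fun y => G (x, y)).
    by apply: measurableT_comp => //; exact: measurable_fun_pair.
  rewrite ge0_integral_normal_prob// -ge0_integralZr//; last 2 first.
  - exact: emeasurable_funM.
  - by move=> y _; exact: mule_ge0.
  by apply: eq_integral => y _; rewrite /p2/= -muleA; congr (_ * _); rewrite muleC.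
have mr : measurable_fun setT
    (fun p : R * R => (c * p.1 + s * p.2, c * p.2 - s * p.1)%R).
  apply: measurable_fun_pair.
    by apply: measurable_funD => //; exact: measurable_funM.
  by apply: measurable_funB => //; exact: measurable_funM.
have mFr : measurable_fun [set: R * R]
    (fun p : R * R => F (c * p.1 + s * p.2, c * p.2 - s * p.1)%R).
  exact: measurableT_comp mr.
pose G (p : R * R) := F p * p2 p.
have mG : measurable_fun [set: R * R] G by exact: emeasurable_funM.
have G0 p : 0 <= G p by apply: mule_ge0 => //; exact: mule_ge0.
transitivity (\int[mu]_x \int[mu]_y
    (F (c * x + s * y, c * y - s * x)%R * p2 (x, y))).
  exact: (key _ mFr (fun p => F0 _)).
transitivity (\int[mu]_x \int[mu]_y G (x, y)); last exact/esym/(key _ mF F0).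
transitivity (\int[mu]_x \int[mu]_y G (c * x + s * y, c * y - s * x)%R); last first.
  exact: (integral2_rotation cs c1 mG G0).
apply: eq_integral => x _; apply: eq_integral => y _; congr (_ * _).
rewrite /p2/= -!EFinM !normal_pdfE//; congr EFin.
rewrite mulrACA [RHS]mulrACA; congr (_ * _)%R.
rewrite /normal_fun -!expRD; congr expR.
rewrite !subr0 !mulNr -!opprD -!mulrDl; congr (- (_ * _))%R.
rewrite (_ : (c * x + s * y) ^+ 2 + (c * y - s * x) ^+ 2 =
  (c ^+ 2 + s ^+ 2) * (x ^+ 2 + y ^+ 2))%R; last by ring.
by rewrite cs mul1r.
Qed.

End gaussian.

(** * Iterated integration over independent Gaussian coordinates *)

Section coordinates.
Variables (R : realType) (K : finType).

(** A pi-system that generates the product sigma-algebra on functions K -> R: finite measures on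
    [cube] are compared on boxes, where independence is a product formula. *)
Definition boxes : set (set (K -> R)) :=
  [set B | exists2 A : K -> set R, (forall k, measurable (A k)) &
    B = [set z | forall k, A k (z k)]].

Definition cube := g_sigma_algebraType boxes.
HB.instance Definition _ := Measurable.on cube.

Lemma measurable_coord (k : K) : measurable_fun [set: cube] (fun z : cube => z k).
Proof.
move=> _ A mA; rewrite setTI; apply: sub_sigma_algebra.
exists (fun j => if j == k then A else setT).
  by move=> j; case: ifP.
apply/seteqP; split => z /=; last by move=> /(_ k); rewrite eqxx.
by move=> Azk j; case: ifPn => // /eqP ->.
Qed.

Lemma measurable_cube d (T : measurableType d) (X : T -> cube) :
  (forall k, measurable_fun [set: T] (fun t => X t k)) -> measurable_fun [set: T] X.
Proof.
move=> mX.
have H := @measurability _ _ T (g_sigma_algebraType boxes) setT X boxes erefl.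
apply: H => _ [_ [A mA ->] <-].
rewrite setTI (_ : _ @^-1` _ = \big[setI/setT]_(k : K) ((fun t => X t k) @^-1` A k)).
  by apply: bigsetI_measurable => k _; have := mX k measurableT _ (mA k); rewrite setTI.
apply/seteqP; split => t /=.
  by move=> At; apply: (big_ind (fun B : set T => B t)) => //; last by move=> k _; exact: At.
move=> At k; move: At; rewrite (bigD1 k)//= => -[]; exact.
Qed.

Definition upd (z : cube) (i : K) (y : R) : cube :=
  fun k => if k == i then y else z k.

Lemma measurable_upd i : measurable_fun [set: cube * R]
  (fun p : cube * R => upd p.1 i p.2).
Proof.
apply: measurable_cube => k; rewrite /upd; case: (k == i) => /=.
  exact: measurable_snd.
exact: (measurableT_comp (measurable_coord k) measurable_fst).
Qed.

Lemma measurable_updr z i : measurable_fun [set: R] (fun y : R => upd z i y).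
Proof.
by apply: measurable_cube => k; rewrite /upd; case: (k == i).
Qed.

Lemma updC z i j x y : i != j -> upd (upd z i x) j y = upd (upd z j y) i x.
Proof.
move=> ij; apply/funext => k; rewrite /upd.
by case: eqVneq => [->|//]; rewrite eq_sym (negbTE ij).
Qed.

Variable sd : K -> R.
Local Notation gm i := (normal_prob 0 (sd i)).
Local Open Scope ereal_scope.

(* The coordinates outside s are frozen at their values in z. *)
Fixpoint gint (s : seq K) (f : cube -> \bar R) (z : cube) : \bar R :=
  if s is i :: s' then \int[gm i]_y gint s' f (upd z i y) else f z.

Implicit Types (f g : cube -> \bar R) (z : cube).

(* Agreement outside s. *)
Definition agree (s : seq K) z z' := forall k, k \notin s -> z k = z' k.

Lemma agree_cons i (s : seq K) z z' y : agree s (upd z i y) z' -> agree (i :: s) z z'.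
Proof.
move=> zz' k; rewrite inE negb_or => /andP[ki ks].
by rewrite -zz'// /upd (negbTE ki).
Qed.

Lemma gint_cat (s t : seq K) f z : gint (s ++ t) f z = gint s (gint t f) z.
Proof. by elim: s z => //= i s IH z; apply: eq_integral => y _; rewrite IH. Qed.

Lemma gint_ge0 (s : seq K) f z : (forall z, 0 <= f z) -> 0 <= gint s f z.
Proof.
by move=> f0; elim: s z => //= i s IH z; apply: integral_ge0 => y _; exact: IH.
Qed.

Lemma measurable_gint (s : seq K) f : measurable_fun [set: cube] f -> (forall z, 0 <= f z) ->
  measurable_fun [set: cube] (gint s f).
Proof.
move=> mf f0; elim: s => //= i s IH.
apply: (measurable_fun_fubini_tonelli_F (m2 := gm i)
  (fun p : cube * R => gint s f (upd p.1 i p.2))).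
- exact: (measurableT_comp IH (measurable_upd i)).
- by move=> p; exact: gint_ge0.
Qed.

Lemma measurable_gint_upd (s : seq K) f z i :
  measurable_fun [set: cube] f -> (forall z, 0 <= f z) ->
  measurable_fun [set: R] (fun y => gint s f (upd z i y)).
Proof.
move=> mf f0; exact: (measurableT_comp (measurable_gint s mf f0) (measurable_updr z i)).
Qed.

(** The comparison is asked only at points agreeing with z outside s, so whatever depends on frozen
    coordinates alone acts as a constant. *)
Lemma le_gint (s : seq K) f g z : measurable_fun [set: cube] f -> (forall z, 0 <= f z) ->
  measurable_fun [set: cube] g -> (forall z, 0 <= g z) ->
  (forall z', agree s z z' -> f z' <= g z') -> gint s f z <= gint s g z.
Proof.
move=> mf f0 mg g0; elim: s z => [z|i s IH z] fg /=; first exact: fg.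
apply: ge0_le_integral => //.
- by move=> y _; exact: gint_ge0.
- exact: measurable_gint_upd.
- exact: measurable_gint_upd.
- by move=> y _; apply: IH => z' /agree_cons; exact: fg.
Qed.

Lemma eq_gint (s : seq K) f g z : (forall z', agree s z z' -> f z' = g z') ->
  gint s f z = gint s g z.
Proof.
elim: s z => [z|i s IH z] fg /=; first exact: fg.
by apply: eq_integral => y _; apply: IH => z' /agree_cons; exact: fg.
Qed.

Lemma gint_cst (s : seq K) (c : \bar R) z : 0 <= c -> gint s (fun=> c) z = c.
Proof.
move=> c0; elim: s z => //= i s IH z.
under eq_integral do rewrite IH.
by rewrite integral_cst// [X in _ * X](@probability_setT _ _ R (gm i)) mule1.
Qed.

Lemma gintD (s : seq K) f g z : measurable_fun [set: cube] f -> (forall z, 0 <= f z) ->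
  measurable_fun [set: cube] g -> (forall z, 0 <= g z) ->
  gint s (fun z => f z + g z) z = gint s f z + gint s g z.
Proof.
move=> mf f0 mg g0; elim: s z => //= i s IH z.
under eq_integral do rewrite IH.
rewrite ge0_integralD//.
- by move=> y _; exact: gint_ge0.
- exact: measurable_gint_upd.
- by move=> y _; exact: gint_ge0.
- exact: measurable_gint_upd.
Qed.

Lemma gintZl (s : seq K) (c : R) f z : (0 <= c)%R ->
  measurable_fun [set: cube] f -> (forall z, 0 <= f z) ->
  gint s (fun z => c%:E * f z) z = c%:E * gint s f z.
Proof.
move=> c0 mf f0; elim: s z => //= i s IH z.
under eq_integral do rewrite IH.
rewrite ge0_integralZl//.
- exact: measurable_gint_upd.
- by move=> y _; exact: gint_ge0.
Qed.

Lemma gint_swap i j (s : seq K) f z : measurable_fun [set: cube] f -> (forall z, 0 <= f z) ->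
  gint [:: i, j & s] f z = gint [:: j, i & s] f z.
Proof.
move=> mf f0; have [->//|ij] := eqVneq i j.
rewrite /=; transitivity (\int[gm j]_y \int[gm i]_x gint s f (upd (upd z i x) j y)).
  apply: (fubini_tonelli (m1 := gm i) (m2 := gm j)
    (fun p : R * R => gint s f (upd (upd z i p.1) j p.2))).
  - apply: (measurableT_comp (measurable_gint s mf f0)).
    apply: measurable_cube => k; rewrite /upd; case: (k == j); [exact: measurable_snd|].
    by case: (k == i); [exact: measurable_fst|exact: measurable_cst].
  - by move=> p; exact: gint_ge0.
by apply: eq_integral => y _; apply: eq_integral => x _; rewrite updC.
Qed.

Lemma gint_move i (s t : seq K) f z : measurable_fun [set: cube] f -> (forall z, 0 <= f z) ->
  gint (s ++ i :: t) f z = gint (i :: s ++ t) f z.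
Proof.
move=> mf f0; elim: s z => [//|j s IH z].
transitivity (gint [:: j, i & s ++ t] f z); last exact: gint_swap.
by apply: eq_integral => y _; exact: IH.
Qed.

(** Tonelli's theorem exchanges neighbours, which generates all permutations. Any sub-block can thus
    be integrated innermost with the rest frozen. *)
Lemma perm_gint (s t : seq K) f z : measurable_fun [set: cube] f -> (forall z, 0 <= f z) ->
  perm_eq s t -> gint s f z = gint t f z.
Proof.
move=> mf f0; elim: s t z => [t z|i s IH t z st].
  by rewrite perm_sym => /perm_nilP ->.
have : i \in t by rewrite -(perm_mem st) mem_head.
move=> /splitPr tE; case: tE st => t1 t2 st.
rewrite gint_move//=; apply: eq_integral => y _; apply: IH.
by rewrite -(perm_cons i); apply: (perm_trans st); rewrite (perm_catCA t1 [:: i] t2).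
Qed.

Definition rot2 (a b : K) (c s : R) (z : cube) : cube :=
  fun k => if k == a then (c * z a + s * z b)%R
           else if k == b then (c * z b - s * z a)%R else z k.

Lemma measurable_rot2 a b (c s : R) : measurable_fun [set: cube] (rot2 a b c s).
Proof.
apply: measurable_cube => k; rewrite /rot2; case: (k == a).
  by apply: measurable_funD; apply: measurable_funM => //; exact: measurable_coord.
case: (k == b); last exact: measurable_coord.
by apply: measurable_funB; apply: measurable_funM => //; exact: measurable_coord.
Qed.

Lemma gint_rot2 a b (c s : R) f z : a != b -> sd a = sd b -> (sd a != 0)%R ->
  (c ^+ 2 + s ^+ 2 = 1)%R -> (c != -1)%R ->
  measurable_fun [set: cube] f -> (forall z, 0 <= f z) ->
  gint [:: a; b] (f \o rot2 a b c s) z = gint [:: a; b] f z.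
Proof.
move=> ab sdab sda cs c1 mf f0 /=; rewrite -sdab.
have ba : (b == a) = false by rewrite eq_sym; exact/negbTE.
pose F (p : R * R) := f (upd (upd z a p.1) b p.2).
have mF : measurable_fun [set: R * R] F.
  apply: (measurableT_comp mf).
  apply: measurable_cube => k; rewrite /upd; case: (k == b); [exact: measurable_snd|].
  by case: (k == a); [exact: measurable_fst|exact: measurable_cst].
transitivity (\int[normal_prob 0 (sd a)]_x \int[normal_prob 0 (sd a)]_y
  F (c * x + s * y, c * y - s * x)%R); last first.
  exact: (normal_prob_rotation sda cs c1 mF (fun p => f0 _)).
apply: eq_integral => x _; apply: eq_integral => y _; congr f; apply/funext => k.
rewrite /rot2 /upd !eqxx (negbTE ab).
case: (eqVneq k a) => [->|_]; first by rewrite (negbTE ab).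
by case: (k == b).
Qed.

End coordinates.

(** * One-dimensional Gaussian expectations *)

Section gaussian_functionals.
Variable R : realType.
Local Open Scope ereal_scope.

Lemma measurable_gt0 : measurable [set y : R | (0 < y)%R].
Proof.
have -> : [set y : R | (0 < y)%R] = `]0%R, +oo[%classic; last exact: measurable_itv.
by apply/seteqP; split => x; rewrite /= in_itv/= andbT.
Qed.

Lemma measurable_lt0 : measurable [set y : R | (y < 0)%R].
Proof.
have -> : [set y : R | (y < 0)%R] = `]-oo, 0%R[%classic; last exact: measurable_itv.
by apply/seteqP; split => x; rewrite /= in_itv/=.
Qed.

Lemma normal_prob_set1 (s a : R) : normal_prob 0 s [set a] = 0.
Proof.
have /null_content_dominatesP := normal_prob_dominates 0%R s.
by apply; [exact: measurable_set1|exact: lebesgue_measure_set1].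
Qed.

Lemma normal_prob_lt0 (s : R) : (s != 0)%R ->
  normal_prob 0 s [set y | (y < 0)%R] = normal_prob 0 s [set y | (0 < y)%R].
Proof.
move=> s0.
have mpos := measurable_gt0.
have mneg := measurable_lt0.
pose F (A : set R) (y : R) := ((\1_A y)%:E * (normal_pdf 0 s y)%:E) : \bar R.
have E (A : set R) : measurable A -> normal_prob 0 s A = \int[lebesgue_measure]_y F A y.
  move=> mA; rewrite /normal_prob integral_mkcond; apply: eq_integral => y _.
  by rewrite patchE /F indicE; case: ifP; rewrite ?mul1e ?mul0e.
rewrite !E// -[RHS]integral_opp.
- apply: eq_integral => y _; rewrite /F !indicE; congr (_ * _).
    congr ((nat_of_bool _)%:R%:E); apply/idP/idP.
      by rewrite !inE/= oppr_gt0.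
    by rewrite !inE/= oppr_gt0.
  by rewrite !normal_pdfE// /normal_fun !subr0 sqrrN.
- apply: emeasurable_funM.
    by apply/measurable_EFinP; exact: measurable_indic.
  by apply/measurable_EFinP; exact: measurable_normal_pdf.
- by move=> y; rewrite /F mule_ge0// lee_fin// normal_pdf_ge0.
Qed.

Lemma normal_prob_gt0 (s : R) : (s != 0)%R ->
  normal_prob 0 s [set y | (0 < y)%R] = (2^-1)%:E.
Proof.
move=> s0; have E := normal_prob_lt0 s0.
have mpos := measurable_gt0.
have mneg := measurable_lt0.
have := @probability_setT _ _ R (normal_prob 0 s).
have -> : [set: R] = [set y : R | (0 < y)%R] `|` ([set y | (y < 0)%R] `|` [set 0%R]).
  apply/seteqP; split => // x _ /=.
  by case: (ltrgtP x 0%R) => [x0|x0|->]; [right; left|left|right; right].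
rewrite measureU//; last 2 first.
- by apply: measurableU => //; exact: measurable_set1.
- apply/seteqP; split => // x [/= x0 [/= x1|/= x1]].
    by have := lt_trans x0 x1; rewrite ltxx.
  by rewrite x1 ltxx in x0.
rewrite [X in _ + X]measureU//; last first.
  by apply/seteqP; split => // x [/= x0 /= x1]; rewrite x1 ltxx in x0.
rewrite [X in _ + (_ + X)](_ : _ = 0); last exact: normal_prob_set1.
rewrite adde0 [X in _ + X](_ : _ = normal_prob 0 s [set y | (0 < y)%R]); last exact: E.
move=> H.
have finP : normal_prob 0 s [set y | (0 < y)%R] \is a fin_num.
  exact: (fin_num_measure (normal_prob 0 s)).
have {H} : normal_prob 0 s [set y | (0 < y)%R] +
  normal_prob 0 s [set y | (0 < y)%R] = 1 by exact: H.
move: finP; case: (normal_prob 0 s _) => // p _ [pE].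
by congr EFin; lra.
Qed.

Lemma integral_normal_prob_sign (s a b : R) : (s != 0)%R -> (0 <= a)%R -> (0 <= b)%R ->
  \int[normal_prob 0 s]_y (if (0 < y)%R then a else b)%:E = ((a + b) / 2)%:E.
Proof.
move=> s0 a0 b0.
have mpos := measurable_gt0.
have mi (A : set R) : measurable A -> measurable_fun [set: R] (fun y => (\1_A y : R)%:E).
  by move=> mA; apply/measurable_EFinP; exact: measurable_indic.
pose A := [set y : R | (0 < y)%R].
have P1 : normal_prob 0 s (~` A) = (2^-1)%:E.
  have := @probability_setC _ _ R (normal_prob 0 s) A mpos.
  rewrite [X in _ - X](_ : _ = (2^-1)%:E); last exact: normal_prob_gt0.
  by move=> ->; rewrite -EFinB; congr EFin; lra.
transitivity (\int[normal_prob 0 s]_y (a%:E * (\1_A y)%:E + b%:E * (\1_(~` A) y)%:E)).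
  apply: eq_integral => y _; rewrite !indicE in_setC.
  have -> : (y \in A) = (0 < y)%R by apply/idP/idP; rewrite inE.
  by case: ifP => _ /=; rewrite ?mule1 ?mule0 ?adde0 ?add0e.
rewrite ge0_integralD//; last 4 first.
- by move=> y _; rewrite mule_ge0// lee_fin.
- by apply: measurable_funeM; exact: mi.
- by move=> y _; rewrite mule_ge0// lee_fin.
- by apply: measurable_funeM; apply: mi; exact: measurableC.
rewrite !ge0_integralZl//; last 2 first.
- by apply: mi; exact: measurableC.
- exact: mi.
rewrite !integral_indic// ?setIT; last exact: measurableC.
rewrite [X in _ * X + _](_ : _ = (2^-1)%:E); last exact: normal_prob_gt0.
rewrite [X in _ + _ * X](_ : _ = (2^-1)%:E); last exact: P1.
by rewrite -!EFinM -EFinD mulrDl.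
Qed.

(** Completing the square: the integrand times the density is a constant times the density of mean
    [m'] and standard deviation [s'], and this constant is the value. *)
Lemma integral_normal_prob_expR_sqr (s l a b : R) : (s != 0)%R -> (0 <= l)%R ->
  let V := (1 + 2 * l * s ^+ 2 * b ^+ 2)%R in
  \int[normal_prob 0 s]_y (expR (- (l * (a + b * y) ^+ 2)))%:E =
  ((Num.sqrt V)^-1 * expR (- (l * a ^+ 2 / V)))%:E.
Proof.
move=> s0 l0 V.
have V0 : (0 < V)%R.
  by rewrite /V ltr_pwDl// mulr_ge0 ?sqr_ge0// mulr_ge0 ?sqr_ge0// mulr_ge0.
pose m' := (- (2 * l * a * b * s ^+ 2 / V))%R.
pose s' := (s / Num.sqrt V)%R.
have sV0 : (0 < Num.sqrt V)%R by rewrite sqrtr_gt0.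
have s'0 : (s' != 0)%R by rewrite mulf_neq0// invr_neq0// gt_eqF.
have s'2 : (s' ^+ 2 = s ^+ 2 / V)%R by rewrite exprMn exprVn sqr_sqrtr// ltW.
rewrite ge0_integral_normal_prob; last 2 first.
- apply/measurable_EFinP; apply: measurableT_comp => //=; apply: measurableT_comp => //=.
  apply: measurable_funM => //=; apply: measurable_funX => //=.
  by apply: measurable_funD => //=; exact: measurable_funM.
- by move=> y; rewrite lee_fin expR_ge0.
transitivity (\int[lebesgue_measure]_y (((Num.sqrt V)^-1 * expR (- (l * a ^+ 2 / V)))%:E *
  (normal_pdf m' s' y)%:E)).
  apply: eq_integral => y _; rewrite -!EFinM; congr EFin.
  rewrite !normal_pdfE// /normal_peak /normal_fun.
  have -> : (s' ^+ 2 * pi *+ 2 = (s ^+ 2 * pi *+ 2) / V)%R by rewrite s'2; ring.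
  rewrite sqrtrM; last by rewrite mulrn_wge0// mulr_ge0 ?sqr_ge0 ?pi_ge0.
  rewrite sqrtrV ?ltW// invfM invrK.
  set P := (Num.sqrt _)^-1%R.
  have -> : ((Num.sqrt V)^-1 * expR (- (l * a ^+ 2 / V)) *
    (P * Num.sqrt V * expR (- (y - m') ^+ 2 / (s' ^+ 2 *+ 2))) =
    P * ((Num.sqrt V)^-1 * Num.sqrt V) *
     (expR (- (l * a ^+ 2 / V)) * expR (- (y - m') ^+ 2 / (s' ^+ 2 *+ 2))))%R by ring.
  rewrite mulVf ?gt_eqF// mulr1 mulrCA; congr (_ * _)%R.
  rewrite -!expRD; congr expR; rewrite s'2 /m' /V.
  have V0' : (1 + 2 * l * s ^+ 2 * b ^+ 2 != 0)%R by rewrite gt_eqF.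
  by field; rewrite s0 V0'.
rewrite ge0_integralZl//.
- by rewrite integral_normal_pdf mule1.
- by apply/measurable_EFinP; exact: measurable_normal_pdf.
- by move=> y _; rewrite lee_fin normal_pdf_ge0.
Qed.

End gaussian_functionals.

(** * Integrals over blocks, conditional probabilities, exponential Markov inequality *)

Section block_integrals.
Variables (R : realType) (K : finType) (sd : K -> R).
Local Notation cube := (@cube R K).
Local Open Scope ereal_scope.
Implicit Types (z : cube) (A B : set cube).

(** Laplace transform of the square of a Gaussian linear form. The offset [a] collects the
    coordinates already fixed; integrating the others returns the same shape with l divided by [V'],
    which closes the induction. *)
Lemma gint_expR_sqr (s : seq K) (sg l a : R) (b : K -> R) z :
  uniq s -> (forall i, i \in s -> sd i = sg) -> (sg != 0)%R -> (0 <= l)%R ->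
  let V := (1 + 2 * l * sg ^+ 2 * \sum_(i <- s) b i ^+ 2)%R in
  gint sd s (fun z => (expR (- (l * (a + \sum_(i <- s) b i * z i) ^+ 2)))%:E) z =
  ((Num.sqrt V)^-1 * expR (- (l * a ^+ 2 / V)))%:E.
Proof.
move=> + + sg0; elim: s l a z => [|i s IH] l a z us sdE l0 /=.
  by rewrite !big_nil mulr0 !addr0 sqrtr1 invr1 mul1r mulr1.
move: us => /= /andP[insub us].
pose V' := (1 + 2 * l * sg ^+ 2 * \sum_(i <- s) b i ^+ 2)%R.
have S0 : (0 <= \sum_(i <- s) b i ^+ 2)%R by apply: sumr_ge0 => j _; exact: sqr_ge0.
have V'0 : (0 < V')%R.
  by rewrite /V' ltr_pwDl// mulr_ge0// mulr_ge0 ?sqr_ge0// mulr_ge0.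
transitivity (\int[normal_prob 0 sg]_y ((Num.sqrt V')^-1%:E *
   (expR (- (l / V' * (a + b i * y) ^+ 2)))%:E)).
  rewrite sdE ?mem_head//; apply: eq_integral => y _.
  rewrite (@eq_gint _ _ _ _ _ (fun z => (expR (- (l * ((a + b i * y)
     + \sum_(i <- s) b i * z i) ^+ 2)))%:E)); last first.
    move=> z' ag; rewrite big_cons addrA.
    by rewrite -(ag i insub) /upd eqxx.
  rewrite IH//; last by move=> j js; apply: sdE; rewrite in_cons js orbT.
  by rewrite -/V' -EFinM mulrAC.
have mE : measurable_fun [set: R] (fun y : R => (expR (- (l / V' * (a + b i * y) ^+ 2)))%:E).
  apply/measurable_EFinP; apply: measurableT_comp => //=; apply: measurableT_comp => //=.
  apply: measurable_funM => //=; apply: measurable_funX => //=.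
  by apply: measurable_funD => //=; exact: measurable_funM.
rewrite ge0_integralZl//.
rewrite integral_normal_prob_expR_sqr//; last by rewrite divr_ge0// ltW.
rewrite -EFinM [X in X%:E = _]mulrA.
rewrite -invfM -sqrtrM ?ltW// big_cons.
have -> : (V' * (1 + 2 * (l / V') * sg ^+ 2 * b i ^+ 2) =
  1 + 2 * l * sg ^+ 2 * (b i ^+ 2 + \sum_(j <- s) b j ^+ 2))%R.
  rewrite [in RHS]mulrDr [in RHS]addrCA -/V' mulrDr mulr1 addrC; congr (_ + _)%R.
  by field; rewrite gt_eqF.
set V := (1 + _)%R.
have V0 : (0 < V)%R.
  by rewrite /V ltr_pwDl// mulr_ge0 ?addr_ge0 ?sqr_ge0// mulr_ge0 ?sqr_ge0// mulr_ge0.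
congr (_ * expR (- _))%:E.
have -> : (1 + 2 * (l / V') * sg ^+ 2 * b i ^+ 2 = V / V')%R.
  have V'V : (V' = 1 + 2 * l * sg ^+ 2 * \sum_(i <- s) b i ^+ 2)%R by [].
  have VV : (V = V' + 2 * l * sg ^+ 2 * b i ^+ 2)%R by rewrite /V V'V; ring.
  by rewrite VV; field; rewrite gt_eqF.
by field; rewrite !gt_eqF.
Qed.

Definition only_on (s : seq K) (U : Type) (f : cube -> U) :=
  forall z z', (forall k, k \in s -> z k = z' k) -> f z = f z'.

(** Factors on disjoint blocks are independent, so each block contributes one factor m. This is the
    product step of all Chernoff bounds below. *)
Lemma le_gint_prod (I : eqType) (J : seq I) (blk : I -> seq K)
    (F : I -> cube -> R) (m : R) z : uniq J ->
  (forall j, measurable_fun [set: cube] (F j)) -> (forall j z, 0 <= F j z)%R ->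
  (0 <= m)%R ->
  (forall j, j \in J -> forall z, gint sd (blk j) (fun z => (F j z)%:E) z <= m%:E) ->
  (forall j, only_on (blk j) (F j)) ->
  (forall i j k, k \in blk i -> k \in blk j -> i = j) ->
  gint sd (flatten (map blk J)) (fun z => (\prod_(j <- J) F j z)%:E) z
    <= (m ^+ size J)%:E.
Proof.
move=> + mF F0 m0 + oF dj.
have mP (t : seq I) : measurable_fun [set: cube] (fun z => (\prod_(j <- t) F j z)%:E).
  by apply/measurable_EFinP; exact: measurable_prod.
have P0 (t : seq I) z' : 0 <= (\prod_(j <- t) F j z')%:E.
  by rewrite lee_fin prodr_ge0.
elim: J z => [|i J IH] z /=.
  by move=> _ _; rewrite big_nil expr0.
move=> /andP[iJ uJ] Hm; rewrite gint_cat.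
have mFE j : measurable_fun [set: cube] (fun z => (F j z)%:E) by exact/measurable_EFinP.
apply: (@le_trans _ _ (gint sd (blk i) (fun z => (m ^+ size J)%:E * (F i z)%:E) z)).
  apply: le_gint.
  - exact: measurable_gint.
  - by move=> z'; exact: gint_ge0.
  - exact: measurable_funeM.
  - by move=> z'; rewrite mule_ge0// lee_fin// exprn_ge0.
  move=> z' _.
  rewrite (@eq_gint _ _ _ _ _ (fun y => (F i z')%:E * (\prod_(j <- J) F j y)%:E)); last first.
    move=> y ag; rewrite big_cons EFinM; congr (_%:E * _); apply: oF => k ki.
    rewrite ag//; apply/negP => /flattenP[_ /mapP[j jJ ->] kj].
    by move: iJ; rewrite (dj _ _ _ ki kj) jJ.
  rewrite gintZl// muleC; apply: lee_wpmul2r; first by rewrite lee_fin.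
  by apply: IH => // j jJ z''; apply: Hm; rewrite in_cons jJ orbT.
rewrite gintZl//; last 2 first.
- by rewrite exprn_ge0.
- by move=> y; rewrite lee_fin.
rewrite exprSr EFinM; apply: lee_wpmul2l; first by rewrite lee_fin exprn_ge0.
by apply: Hm; rewrite mem_head.
Qed.

(** The conditional probability of A given the coordinates outside s, which are read off from z. *)
Definition pr (s : seq K) A z : \bar R := gint sd s (fun z => (\1_A z)%:E) z.

Lemma measurable_indicE A : measurable A ->
  measurable_fun [set: cube] (fun z => (\1_A z : R)%:E).
Proof. by move=> mA; apply/measurable_EFinP; exact: measurable_indic. Qed.

Lemma indicE_ge0 A z : 0 <= (\1_A z : R)%:E.
Proof. by rewrite lee_fin. Qed.
#[local] Hint Resolve measurable_indicE indicE_ge0 : core.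

Lemma pr_ge0 s A z : 0 <= pr s A z.
Proof. by apply: gint_ge0 => z'; exact: indicE_ge0. Qed.

Lemma pr_perm s t A z : measurable A -> perm_eq s t -> pr s A z = pr t A z.
Proof. by move=> mA; apply: perm_gint => [|z']; [exact: measurable_indicE|exact: indicE_ge0]. Qed.

(** Averaging over s against a probability measure preserves a bound valid for all values of those
    coordinates. *)
Lemma pr_cat_le (s t : seq K) A z (e : R) : measurable A ->
  (forall z', agree s z z' -> pr t A z' <= e%:E) -> pr (s ++ t) A z <= e%:E.
Proof.
move=> mA H; rewrite /pr gint_cat.
have e0 : 0 <= e%:E by apply: le_trans (H z _); [exact: pr_ge0|].
rewrite -[leRHS](@gint_cst _ _ sd s e%:E z)//; apply: le_gint => //.
- by apply: measurable_gint => [|z']; [exact: measurable_indicE|exact: indicE_ge0].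
- by move=> z'; exact: pr_ge0.
Qed.

Lemma pr_le (s : seq K) A B z : measurable A -> measurable B ->
  (forall z', agree s z z' -> A z' -> B z') -> pr s A z <= pr s B z.
Proof.
move=> mA mB AB; apply: le_gint => //.
- exact: measurable_indicE.
- exact: measurable_indicE.
- move=> z' ag; rewrite lee_fin !indicE ler_nat.
  case: (boolP (z' \in A)) => //; rewrite inE => /(AB _ ag) ?.
  by rewrite mem_set.
Qed.

Lemma pr_le2 (s : seq K) A B C z : measurable A -> measurable B -> measurable C ->
  (forall z', agree s z z' -> A z' -> B z' \/ C z') ->
  pr s A z <= pr s B z + pr s C z.
Proof.
move=> mA mB mC ABC; rewrite /pr -gintD//; try exact: measurable_indicE.
apply: le_gint => //.
- exact: measurable_indicE.
- by apply: emeasurable_funD; exact: measurable_indicE.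
- by move=> z'; rewrite adde_ge0.
- move=> z' ag; rewrite -EFinD lee_fin !indicE -natrD ler_nat.
  case: (boolP (z' \in A)) => //; rewrite inE => /(ABC _ ag)[?|?].
    by rewrite [z' \in B]mem_set.
  by rewrite [z' \in C]mem_set// addn1.
Qed.

(** Lower-tail form: on A, 1 <= exp(l (r - X)). *)
Lemma pr_markov (s : seq K) A z (X : cube -> R) (l r : R) : measurable A ->
  measurable_fun [set: cube] X -> (0 <= l)%R ->
  (forall z', A z' -> X z' <= r)%R ->
  pr s A z <= (expR (l * r))%:E * gint sd s (fun z => (expR (- (l * X z)))%:E) z.
Proof.
move=> mA mX l0 AX.
have mE : measurable_fun [set: cube] (fun z => (expR (- (l * X z)))%:E).
  apply/measurable_EFinP; apply: measurableT_comp => //; apply: measurableT_comp => //.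
  exact: measurable_funM.
rewrite -gintZl//.
apply: le_gint => //.
- exact: measurable_indicE.
- exact: measurable_funeM.
- move=> z' _; rewrite indicE; case: (boolP (z' \in A)); last first.
    by move=> _; rewrite mule_ge0// lee_fin expR_ge0.
  rewrite inE => /AX Xr; rewrite -EFinM lee_fin -expRD.
  rewrite -[leLHS]expR0 ler_expR -mulrBr mulr_ge0// subr_ge0//.
Qed.

(** Normal laws have no atoms. This discards the weights at which a pre-activation vanishes. *)
Lemma pr_some_zero (s : seq K) z : uniq s ->
  (forall i, i \in s -> sd i != 0)%R ->
  pr s [set z | exists2 k, k \in s & z k = 0%R] z = 0.
Proof.
have mz (t : seq K) : measurable [set z : cube | exists2 k, k \in t & z k = 0%R].
  rewrite [X in measurable X](_ : _ = \big[setU/set0]_(k <- t) [set z : cube | z k = 0%R]).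
    apply: bigsetU_measurable => k _.
    have := @measurable_coord R K k measurableT [set 0%R] (measurable_set1 _).
    by rewrite setTI.
  rewrite -bigcup_seq; apply/seteqP; split => y /=.
    by move=> [k kt yk]; exists k.
  by move=> [k kt yk]; exists k.
elim: s z => [|k s IH] z /=.
  by move=> _ _; rewrite /pr/= indicE memNset// => -[].
move=> /andP[ks us] sd0; apply/eqP; rewrite eq_le pr_ge0 andbT.
have mk : measurable [set z : cube | z k = 0%R].
  have := @measurable_coord R K k measurableT [set 0%R] (measurable_set1 _).
  by rewrite setTI.
rewrite {1}/pr /=.
apply: (@le_trans _ _ (\int[normal_prob 0 (sd k)]_y (\1_[set 0%R] y)%:E)).
  apply: ge0_le_integral => //.
  - by move=> y _; exact: pr_ge0.
  - by apply: measurable_gint_upd => //; apply: measurable_indicE; exact: mz.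
  - by apply/measurable_EFinP; exact: measurable_indic.
  move=> y _; apply: (@le_trans _ _ (pr s [set z | z k = 0%R] (upd z k y) +
     pr s [set z | exists2 k, k \in s & z k = 0%R] (upd z k y))).
    apply: pr_le2 => // z' ag [k']; rewrite in_cons => /orP[/eqP ->|k's z'0].
      by left.
    by right; exists k'.
  rewrite IH//; last by move=> i si; apply: sd0; rewrite in_cons si orbT.
  rewrite adde0 /pr (@eq_gint _ _ _ _ _ (fun=> (\1_[set 0%R] y)%:E)); last first.
    move=> z' /(_ _ ks); rewrite /upd eqxx => yE.
    by rewrite !indicE; congr ((nat_of_bool _)%:R%:E); apply/idP/idP; rewrite !inE/= yE.
  by rewrite gint_cst.
rewrite integral_indic// setIT.
by rewrite [X in X <= _](_ : _ = 0)//; exact: normal_prob_set1.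
Qed.

End block_integrals.

(** * Chernoff bounds for columns of Gaussians *)

Section deviations.
Variables (R : realType) (K : finType) (sd : K -> R).
Local Notation cube := (@cube R K).
Variables (I J : finType) (e : I -> J -> K).
Hypothesis e_inj : forall i j i' j', e i j = e i' j' -> i = i' /\ j = j'.
Variable sg : R.
Hypothesis sdE : forall i j, sd (e i j) = sg.
Hypothesis sg0 : sg != 0.

Definition col j : seq K := [seq e i j | i <- enum I].

Lemma col_uniq j : uniq (col j).
Proof.
by rewrite map_inj_uniq ?enum_uniq// => i i' /e_inj[].
Qed.

Lemma mem_col i j : e i j \in col j.
Proof. by apply: map_f; rewrite mem_enum. Qed.

Lemma col_disj i j k : k \in col i -> k \in col j -> i = j.
Proof. by move=> /mapP[i1 _ ->] /mapP[i2 _ /e_inj[]]. Qed.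

(** Entry j of W^T b for the matrix W with entries [z (e i j)]. For fixed b these entries are
    independent centered normals of variance sg^2 |b|^2. *)
Definition coldot (b : I -> R) (z : cube) (j : J) : R := \sum_i b i * z (e i j).

Lemma measurable_coldot b j : measurable_fun [set: cube] (fun z => coldot b z j).
Proof.
apply: measurable_sum => i; apply: measurable_funM => //.
exact: measurable_coord.
Qed.

Lemma only_on_coldot b j : only_on (col j) (fun z : cube => coldot b z j).
Proof.
move=> z z' zz'; apply: eq_bigr => i _; rewrite zz'//; exact: mem_col.
Qed.

Lemma gint_coldot (b : I -> R) (l : R) j z : 0 <= l ->
  gint sd (col j) (fun z => (expR (- (l * coldot b z j ^+ 2)))%:E) z =
  ((Num.sqrt (1 + 2 * l * sg ^+ 2 * \sum_i b i ^+ 2))^-1)%:E.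
Proof.
move=> l0.
(* Transports b to coefficients indexed by K along the injection sending i to [e i j], with default
   0 off the column. *)
pose b' (k : K) : R := odflt 0 (omap b [pick i | e i j == k]).
have b'E i : b' (e i j) = b i.
  rewrite /b'; case: pickP => [i' /eqP/e_inj[->]//|/(_ i)]; by rewrite eqxx.
have H := @gint_expR_sqr R K sd (col j) sg l 0 b' z (col_uniq j) _ sg0 l0.
have S : \sum_(i <- col j) b' i ^+ 2 = \sum_i b i ^+ 2.
  rewrite big_map big_enum; apply: eq_bigr => i _; by rewrite b'E.
rewrite /= S expr0n/= mulr0 mul0r oppr0 expR0 mulr1 in H.
rewrite -H; last by move=> k /mapP[i _ ->].
apply: eq_gint => z' _; congr (expR (- (l * _ ^+ 2)))%:E.
by rewrite add0r big_map big_enum; apply: eq_bigr => i _; rewrite b'E.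
Qed.

Lemma measurable_sum_lt (s : seq J) (F : J -> cube -> R) (r : R) :
  (forall j, measurable_fun [set: cube] (F j)) ->
  measurable [set z : cube | \sum_(j <- s) F j z < r].
Proof.
move=> mF; have mS : measurable_fun [set: cube] (fun z => \sum_(j <- s) F j z).
  exact: measurable_sum.
have := mS measurableT `]-oo, r[%classic (measurable_itv _).
rewrite setTI; congr measurable; apply/seteqP; split => z /=; by rewrite in_itv.
Qed.

Lemma pr_sum_lt (s : seq J) (F : J -> cube -> R) (l r m : R) z : uniq s ->
  (forall j, measurable_fun [set: cube] (F j)) -> 0 <= l -> 0 <= m ->
  (forall j, only_on (col j) (F j)) ->
  (forall j, j \in s -> forall z,
     gint sd (col j) (fun z => (expR (- (l * F j z)))%:E) z <= m%:E)%E ->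
  (pr sd (flatten (map col s)) [set z | (\sum_(j <- s) F j z < r)%R] z
    <= (expR (l * r) * m ^+ size s)%:E)%E.
Proof.
move=> us mF l0 m0 oF Fm.
apply: (le_trans (pr_markov (X := fun z => \sum_(j <- s) F j z) (l := l) (r := r)
  sd (flatten (map col s)) z _ _ l0 _)).
- exact: measurable_sum_lt.
- exact: measurable_sum.
- by move=> z' /ltW.
rewrite EFinM; apply: lee_wpmul2l; first by rewrite lee_fin expR_ge0.
rewrite (_ : (fun z : cube => _) =
  (fun z => (\prod_(j <- s) expR (- (l * F j z)))%:E)); last first.
  by apply/funext => z'; rewrite -expR_sum mulr_sumr sumrN.
apply: le_gint_prod => //.
- move=> j; apply: measurableT_comp => //; apply: measurableT_comp => //.
  exact: measurable_funM.
- by move=> j z1 z2 /oF ->.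
- by move=> i j k; exact: col_disj.
Qed.

Lemma measurable_coldot_sqr b j :
  measurable_fun [set: cube] (fun z => coldot b z j ^+ 2).
Proof. by apply: measurable_funX; exact: measurable_coldot. Qed.

Lemma measurable_coldot_abs b j :
  measurable_fun [set: cube] (fun z => `|coldot b z j|).
Proof. by apply: measurableT_comp => //; exact: measurable_coldot. Qed.

(** The sum is sg^2 |b|^2 times a chi-square variable with [size s] degrees of freedom; the inverse
    square root is the Laplace transform of one summand. *)
Lemma pr_chisq (s : seq J) (b : I -> R) (l r : R) z : uniq s -> 0 <= l ->
  (pr sd (flatten (map col s)) [set z | (\sum_(j <- s) coldot b z j ^+ 2 < r)%R] z
  <= (expR (l * r) *
      ((Num.sqrt (1 + 2 * l * sg ^+ 2 * \sum_i b i ^+ 2))^-1) ^+ size s)%:E)%E.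
Proof.
move=> us l0; apply: (pr_sum_lt _ z us (measurable_coldot_sqr b)) => //.
- by move=> j z1 z2 /only_on_coldot ->.
- by move=> j _ z'; rewrite gint_coldot.
Qed.

(** Trades |t| for t^2, whose Laplace transform is explicit. If a|t| >= 1 the first term dominates;
    otherwise the second term is at least 1. *)
Lemma expR_abs_le (l a t : R) : 0 < a -> 0 <= l ->
  expR (- (l * `|t|)) <= expR (- (l / a)) + expR 1 * expR (- (a ^+ 2 * t ^+ 2)).
Proof.
move=> a0 l0; have [at1|at1] := leP 1 (a * `|t|).
  rewrite -[leLHS]addr0 lerD ?mulr_ge0 ?expR_ge0// ler_expR lerN2 ler_wpM2l//.
  by rewrite -[leLHS]mul1r ler_pdivrMr// mulrC.
rewrite -[leLHS]add0r lerD ?expR_ge0// -expRD.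
apply: (@le_trans _ _ 1).
  by rewrite -[leRHS]expR0 ler_expR oppr_le0 mulr_ge0.
rewrite -[leLHS]expR0 ler_expR subr_ge0 -(real_normK (num_real t)) -exprMn.
by apply: exprn_ile1; [rewrite mulr_ge0// ltW|exact: ltW].
Qed.

Lemma pr_l1 (s : seq J) (b : I -> R) (l a r : R) z : uniq s -> 0 <= l -> 0 < a ->
  (pr sd (flatten (map col s)) [set z | (\sum_(j <- s) `|coldot b z j| < r)%R] z
  <= (expR (l * r) * (expR (- (l / a)) + expR 1 *
      (Num.sqrt (1 + 2 * a ^+ 2 * sg ^+ 2 * \sum_i b i ^+ 2))^-1) ^+ size s)%:E)%E.
Proof.
move=> us l0 a0; apply: (pr_sum_lt _ z us (measurable_coldot_abs b)) => //.
- by move=> j z1 z2 /only_on_coldot ->.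
move=> j _ z'; have me (c : R) (G : cube -> R) : measurable_fun [set: cube] G ->
    measurable_fun [set: cube] (fun z => (expR (- (c * G z)))%:E).
  move=> mG; apply/measurable_EFinP; apply: measurableT_comp => //.
  by apply: measurableT_comp => //; exact: measurable_funM.
have e0 (x : R) : (0 <= (expR x)%:E)%E by rewrite lee_fin expR_ge0.
apply: (@le_trans _ _ (gint sd (col j) (fun z => (expR (- (l / a)))%:E +
  (expR 1)%:E * (expR (- (a ^+ 2 * coldot b z j ^+ 2)))%:E) z')%E).
  apply: le_gint => //.
  - by apply: me; exact: measurable_coldot_abs.
  - apply: emeasurable_funD => //; apply: measurable_funeM; apply: me.
    exact: measurable_coldot_sqr.
  - by move=> z0; rewrite adde_ge0// mule_ge0.
  - by move=> z0 _; rewrite -EFinM -EFinD lee_fin expR_abs_le.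
rewrite gintD//; last by apply: measurable_funeM; apply: me; exact: measurable_coldot_sqr.
rewrite gint_cst// gintZl ?expR_ge0//; last first.
  by apply: me; exact: measurable_coldot_sqr.
by rewrite gint_coldot// ?sqr_ge0.
Qed.

(** The signs in a column are independent fair coins, and (1 + exp(-l))/2 is the Laplace transform
    of one of them. The blocks here are single entries. *)
Lemma pr_few_positive (j : J) (l r : R) z : 0 <= l ->
  (pr sd (col j) [set z : cube | (\sum_i (0 < z (e i j))%R%:R < r)%R] z
   <= (expR (l * r) * ((1 + expR (- l)) / 2) ^+ #|I|)%:E)%E.
Proof.
move=> l0.
have mp (k : K) : measurable_fun [set: cube] (fun z : cube => (0 < z k)%R%:R : R).
  rewrite (_ : (fun z : cube => _) = \1_[set z : cube | 0 < z k]).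
    apply: measurable_indic.
    by have := measurable_coord k measurableT (@measurable_gt0 R); rewrite setTI.
  by apply/funext => y; rewrite indicE; congr ((nat_of_bool _)%:R); apply/idP/idP; rewrite inE.
apply: (le_trans (pr_markov (X := fun z => \sum_i (0 < z (e i j))%R%:R) (l := l) (r := r)
  sd (col j) z _ _ l0 _)).
- have mS : measurable_fun [set: cube] (fun z => \sum_i (0 < z (e i j))%R%:R : R).
    exact: measurable_sum.
  have := mS measurableT `]-oo, r[%classic (measurable_itv _).
  rewrite setTI; congr measurable; apply/seteqP; split => y /=; by rewrite in_itv.
- by apply: measurable_sum => i; exact: mp.
- by move=> z' /ltW.
rewrite EFinM; apply: lee_wpmul2l; first by rewrite lee_fin expR_ge0.
rewrite (_ : (fun z : cube => _) =
  (fun z => (\prod_(i <- enum I) expR (- (l * (0 < z (e i j))%R%:R)))%:E)); last first.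
  by apply/funext => z'; rewrite -expR_sum big_enum/= mulr_sumr sumrN.
have -> : col j = flatten [seq [:: e i j] | i <- enum I].
  by rewrite /col; elim: (enum I) => //= i s ->.
rewrite cardE; apply: (@le_gint_prod R K sd I (enum I) (fun i => [:: e i j])
  (fun i z => expR (- (l * (0 < z (e i j))%R%:R)))).
- exact: enum_uniq.
- move=> i; apply: measurableT_comp => //; apply: measurableT_comp => //.
  exact: measurable_funM.
- by move=> i z'; exact: expR_ge0.
- by rewrite divr_ge0// addr_ge0// expR_ge0.
- move=> i _ z' /=; rewrite sdE.
  rewrite (_ : (fun y : R => _) = (fun y : R => (if 0 < y then expR (- l) else 1)%:E)).
    rewrite [X in (X <= _)%E]integral_normal_prob_sign//.
    by rewrite addrC.
  apply/funext => y; rewrite /upd eqxx; congr EFin.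
  by case: ifP => _; rewrite ?mulr1// mulr0 oppr0 expR0.
- by move=> i z1 z2 /(_ (e i j)) ->//; rewrite mem_seq1.
- by move=> i i' k; rewrite !mem_seq1 => /eqP -> /eqP /e_inj[].
Qed.

End deviations.

(** * From independent random parameters to iterated integrals *)

Section integration_of_independent.
Variables (R : realType) (K : finType) (sd : K -> R).
Local Notation cube := (@cube R K).
Context d (T : measurableType d) (P : probability T R) (Z : K -> {RV P >-> R}).
Hypothesis indep : mutually_independent Z.
Local Open Scope ereal_scope.

Let Zt (t : T) : cube := fun k => Z k t.

Lemma measurable_joint : measurable_fun [set: T] Zt.
Proof. by apply: measurable_cube => k; exact: measurable_funP. Qed.

Lemma integral_joint_coord (i : K) (f : cube -> \bar R) :
  (forall A : set R, measurable A -> distribution P (Z i) A = normal_prob 0 (sd i) A) ->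
  measurable_fun [set: cube] f -> (forall z, 0 <= f z) ->
  \int[P]_t f (Zt t) = \int[P]_t gint sd [:: i] f (Zt t).
Proof.
move=> lawi mf f0.
pose phi (p : T * R) : cube := upd (Zt p.1) i p.2.
have mphi : measurable_fun [set: T * R] phi.
  have mp : measurable_fun [set: T * R] (fun p : T * R => (Zt p.1, p.2)).
    apply: measurable_fun_pair => //.
    exact: (measurableT_comp measurable_joint measurable_fst).
  exact: (measurableT_comp (measurable_upd i) mp).
pose gi : {sigma_finite_measure set _ -> \bar R} := normal_prob 0 (sd i).
pose Q := P \x gi.
have E A : measurable A -> pushforward P Zt A = pushforward Q phi A.
  move=> mA; pose g : (set cube)^nat := fun=> setT.
  apply: (@measure_unique _ R cube (@boxes R K) g) => //.
  - move=> _ _ [A1 mA1 ->] [A2 mA2 ->]; exists (fun k => A1 k `&` A2 k).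
      by move=> k; exact: measurableI.
    by apply/seteqP; split => [y [/= y1 y2] k|y /= yy]; split => // k; have [] := yy k.
  - by move=> n; exists (fun=> setT) => //; apply/seteqP; split.
  - by apply/seteqP; split => // y _; exists 0%N.
  - exact: measurable_joint.
  - move=> ? _ [B mB ->]; rewrite /= /pushforward.
    have -> : Zt @^-1` [set z | forall k, B k (z k)] =
       \bigcap_(k in [set` [set: K]%SET]) (Z k @^-1` B k).
      apply/seteqP; split => t /= H k; first by move=> _; exact: (H k).
      by apply: (H k); rewrite /= finset.in_setT.
    rewrite indep// (bigD1 i) ?finset.in_setT//=.
    have -> : phi @^-1` [set z | forall k, B k (z k)] =
       (\bigcap_(k in [set` [set~ i]%SET]) (Z k @^-1` B k)) `*` B i.
      apply/seteqP; split => -[t y] /=.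
        move=> H; split.
          by move=> k /=; rewrite !inE => ki; have := H k; rewrite /phi /upd/= (negbTE ki).
        by have := H i; rewrite /phi /upd/= eqxx.
      move=> [H1 H2] k; rewrite /phi /upd/=; case: eqVneq => [->//|ki].
      by apply: (H1 k); rewrite /= !inE.
    rewrite [RHS]product_measure1E//; last 2 first.
    - apply: fin_bigcap_measurable => [|k _]; first exact: finite_finset.
      by rewrite -[_ @^-1` _]setTI; exact: measurable_funP.
    - exact: (mB i).
    rewrite muleC; congr (_ * _); last exact: (lawi _ (mB i)).
    apply/esym; apply: (etrans (indep _ mB)).
    by apply: eq_bigl => k; rewrite !inE.
  - move=> ? k; rewrite /= /pushforward preimage_setT.
    by rewrite [ltLHS](@probability_setT _ _ R P) ltry.
transitivity (\int[pushforward P Zt]_z f z).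
  by rewrite (ge0_integral_pushforward measurable_joint).
transitivity (\int[pushforward Q phi]_z f z).
  by apply: eq_measure_integral => [|? A mA _]; [exact: measurable_joint|exact: E].
transitivity (\int[Q]_p f (phi p)).
  have mphi' : measurable_fun [set: T * measurableTypeR R] phi := mphi.
  have H := @ge0_integral_pushforward _ _ _ _ _ _ mphi' Q setT f measurableT mf
    (fun y _ => f0 y).
  by rewrite preimage_setT in H.
exact: (fubini_tonelli1 (m1 := P) (m2 := gi) _ (measurableT_comp mf mphi) (fun p => f0 _)).
Qed.

Lemma integral_joint (s : seq K) (f : cube -> \bar R) :
  (forall i, i \in s -> forall A : set R, measurable A ->
     distribution P (Z i) A = normal_prob 0 (sd i) A) ->
  measurable_fun [set: cube] f -> (forall z, 0 <= f z) ->
  \int[P]_t f (Zt t) = \int[P]_t gint sd s f (Zt t).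
Proof.
move=> + mf f0; elim: s => // i s IH law.
rewrite IH; last by move=> j js; apply: law; rewrite in_cons js orbT.
rewrite (@integral_joint_coord i)//.
- exact: law (mem_head _ _).
- exact: measurable_gint.
- by move=> z; exact: gint_ge0.
Qed.

Lemma probability_joint_le (s : seq K) (A : set cube) (c : R) :
  (forall i, i \in s -> forall A : set R, measurable A ->
     distribution P (Z i) A = normal_prob 0 (sd i) A) ->
  measurable A -> (forall z, pr sd s A z <= c%:E) -> P [set t | A (Zt t)] <= c%:E.
Proof.
move=> law mA H.
have mZA : measurable [set t | A (Zt t)].
  by have := measurable_joint measurableT mA; rewrite setTI.
have -> : P [set t | A (Zt t)] = \int[P]_t (\1_A (Zt t))%:E.
  transitivity (\int[P]_t (\1_[set t | A (Zt t)] t)%:E).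
    by rewrite integral_indic// setIT.
  apply: eq_integral => t _; rewrite !indicE.
  by congr ((nat_of_bool _)%:R%:E); apply/idP/idP; rewrite !inE.
rewrite (integral_joint law (measurable_indicE mA) (fun z => indicE_ge0 A z)).
rewrite -[leRHS]mule1 -(@probability_setT _ _ R P) -integral_cst//.
apply: ge0_le_integral => //.
- by move=> t _; exact: pr_ge0.
- apply: (measurableT_comp _ measurable_joint).
  by apply: measurable_gint => //; exact: measurable_indicE.
- by move=> t _; exact: H.
Qed.

End integration_of_independent.

(** * Deterministic properties of ReLU networks *)

Section maxnorm.
Variable R : realType.

Definition maxnorm (n : nat) (x : 'cV[R]_n) : R := \big[Num.max/0]_i `|x i ord0|.

Lemma maxnorm_ge n (x : 'cV[R]_n) i : `|x i ord0| <= maxnorm x.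
Proof. exact: (le_bigmax _ (fun i => `|x i ord0|)). Qed.

Lemma maxnorm_le n (x : 'cV[R]_n) (c : R) : 0 <= c ->
  (forall i, `|x i ord0| <= c) -> maxnorm x <= c.
Proof. by move=> c0 H; apply/bigmax_leP; split => // i _; exact: H. Qed.

Lemma maxnorm_ge0 n (x : 'cV[R]_n) : 0 <= maxnorm x.
Proof. exact: bigmax_ge_id. Qed.

Lemma maxnorm_gt0 n (x : 'cV[R]_n) : x != 0 -> 0 < maxnorm x.
Proof.
move=> x0; rewrite lt_neqAle maxnorm_ge0 andbT; apply: contra_neq x0 => /esym x0.
apply/matrixP => i j; rewrite (ord1 j) mxE; apply/eqP; rewrite -normr_le0 -[leRHS]x0.
exact: maxnorm_ge.
Qed.

Lemma maxnormD n (x y : 'cV[R]_n) : maxnorm (x + y) <= maxnorm x + maxnorm y.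
Proof.
apply: maxnorm_le => [|i]; first by rewrite addr_ge0 ?maxnorm_ge0.
by rewrite mxE (le_trans (ler_normD _ _))// lerD ?maxnorm_ge.
Qed.

Lemma maxnormN n (x : 'cV[R]_n) : maxnorm (- x) = maxnorm x.
Proof. by apply: eq_bigr => i _; rewrite mxE normrN. Qed.

Lemma lipschitz_relu (a b : R) : `|relu a - relu b| <= `|a - b|.
Proof.
rewrite /relu; case: (leP 0 a) => a0; case: (leP 0 b) => b0 //.
- rewrite subr0 !ger0_norm//; first by rewrite lerDl oppr_ge0 ltW.
  by rewrite subr_ge0 (le_trans _ a0)// ltW.
- rewrite sub0r normrN ger0_norm// ler0_norm; first by rewrite opprB lerDl oppr_ge0 ltW.
  by rewrite subr_le0 (le_trans _ b0)// ltW.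
- by rewrite subrr normr0.
Qed.

Lemma lipschitz_mulmx m n (W : 'M[R]_(m, n)) :
  exists2 c, 0 <= c & forall x : 'cV_n, maxnorm (W *m x) <= c * maxnorm x.
Proof.
exists (\sum_i \sum_j `|W i j|) => [|x].
  by apply: sumr_ge0 => i _; apply: sumr_ge0 => j _.
apply: maxnorm_le => [|i].
  by rewrite mulr_ge0 ?maxnorm_ge0//; apply: sumr_ge0 => i _; apply: sumr_ge0 => j _.
rewrite mxE (le_trans (ler_norm_sum _ _ _))//.
apply: (@le_trans _ _ (\sum_j `|W i j| * maxnorm x)).
  by apply: ler_sum => j _; rewrite normrM ler_wpM2l ?maxnorm_ge.
rewrite -mulr_suml ler_wpM2r ?maxnorm_ge0//.
rewrite (bigD1 i)//= lerDl; apply: sumr_ge0 => k _; exact: sumr_ge0.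
Qed.

Lemma lipschitz_relu_layer m n (W : 'M[R]_(m, n)) b :
  exists2 c, 0 <= c & forall x y : 'cV_n,
    maxnorm (relu_layer W b x - relu_layer W b y) <= c * maxnorm (x - y).
Proof.
have [c c0 cW] := lipschitz_mulmx W; exists c => // x y.
apply: le_trans (cW (x - y)).
apply: maxnorm_le => [|i]; first exact: maxnorm_ge0.
rewrite !mxE (le_trans (lipschitz_relu _ _))//.
apply: le_trans (maxnorm_ge _ i).
rewrite mulmxBr [X in _ <= `|X|]mxE [X in _ <= `|_ + X|]mxE.
by rewrite !mxE opprD addrACA subrr addr0.
Qed.

(** A crude modulus of continuity, used later to move points to rational ones when proving
    measurability. *)
Lemma lipschitz_relu_net d N L (theta : relu_params R d N L) :
  exists2 c, 0 <= c & forall x y : 'cV_d,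
    `|relu_net theta x - relu_net theta y| <= c * maxnorm (x - y).
Proof.
have hid (ls : seq 'I_L.-1) : exists2 c, 0 <= c & forall x y : 'cV_N,
    maxnorm (foldl (fun y l => relu_layer (W_inner theta l) (b_inner theta l) y) x ls -
             foldl (fun y l => relu_layer (W_inner theta l) (b_inner theta l) y) y ls)
    <= c * maxnorm (x - y).
  elim: ls => [|l ls [c c0 IH]]; first by exists 1 => // x y; rewrite mul1r.
  have [c' c'0 H] := lipschitz_relu_layer (W_inner theta l) (b_inner theta l).
  exists (c * c') => [|x y /=]; first exact: mulr_ge0.
  by rewrite (le_trans (IH _ _))// -mulrA ler_wpM2l.
have [c1 c10 H1] := lipschitz_relu_layer (W_first theta) (b_first theta).
have [c2 c20 H2] := hid (enum 'I_L.-1).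
have [c3 c30 H3] := lipschitz_mulmx (W_last theta).
exists (c3 * (c2 * c1)) => [|x y]; first by rewrite !mulr_ge0.
rewrite /relu_net; set hx := foldl _ _ _; set hy := foldl _ _ _.
apply: (@le_trans _ _ (maxnorm (W_last theta *m (hx - hy)))).
  apply: le_trans (maxnorm_ge _ ord0).
  rewrite mulmxBr [X in _ <= `|X|]mxE [X in _ <= `|_ + X|]mxE.
  by rewrite [X in `|X - _|]mxE [X in `|_ - X|]mxE opprD addrACA subrr addr0.
rewrite (le_trans (H3 _))// -!mulrA ler_wpM2l// (le_trans (H2 _ _))// ler_wpM2l//.
Qed.

Lemma lp_norm_le_maxnorm n (r : R) (x : 'cV[R]_n) : 0 < r ->
  lp_norm r%:E x <= n%:R `^ r^-1 * maxnorm x.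
Proof.
move=> r0; rewrite /lp_norm.
apply: (@le_trans _ _ ((n%:R * maxnorm x `^ r) `^ r^-1)).
  apply: ge0_ler_powR; rewrite ?nnegrE ?invr_ge0 ?(ltW r0)//.
  - by apply: sumr_ge0 => i _; exact: powR_ge0.
  - by rewrite mulr_ge0 ?powR_ge0.
  apply: (@le_trans _ _ (\sum_(i < n) maxnorm x `^ r)); last first.
    by rewrite sumr_const card_ord mulr_natl.
  apply: ler_sum => i _; apply: ge0_ler_powR; rewrite ?nnegrE ?(ltW r0) ?maxnorm_ge0//.
  exact: maxnorm_ge.
by rewrite powRM ?powR_ge0// -powRrM divff ?gt_eqF// powRr1 ?maxnorm_ge0.
Qed.

Lemma lp_norm_gt0 n (r : R) (x : 'cV[R]_n) : 0 < r -> x != 0 -> 0 < lp_norm r%:E x.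
Proof.
move=> r0 x0; rewrite /lp_norm powR_gt0// lt_neqAle eq_sym.
rewrite sumr_ge0 ?andbT; last by move=> i _; exact: powR_ge0.
apply: contra_neq x0 => /eqP; rewrite psumr_eq0; last by move=> i _; exact: powR_ge0.
move=> /allP H; apply/matrixP => i j; rewrite (ord1 j) mxE.
have /implyP/(_ isT) := H i (mem_index_enum _).
by rewrite powR_eq0 normr_eq0 => /andP[/eqP].
Qed.

(* ||x||_p <= d^(1/p) ||x||_oo, so the bound for p = +oo implies all others. *)
Lemma lipschitz_const_oo_all d (f : 'cV[R]_d -> R) (c : R) : (0 < d)%N -> 0 < c ->
  ((c * d%:R)%:E <= lipschitz_const +oo%E f)%E ->
  forall p : \bar R, (2%:E <= p)%E ->
    ((c * d%:R `^ (1 - fine p^-1%E))%:E <= lipschitz_const p f)%E.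
Proof.
move=> d0 c0 H [r| |] // p2; last first.
  by rewrite invey/= subr0 powRr1.
have r0 : 0 < r by move: p2; rewrite lee_fin; apply: lt_le_trans.
have dr : (0 : R) < d%:R `^ r^-1 by apply: powR_gt0; rewrite ltr0n.
rewrite inver gt_eqF//= powRD; last first.
  by rewrite pnatr_eq0 -lt0n d0 implybT.
rewrite powRr1// powRN.
suff H' : (lipschitz_const +oo%E f <= (d%:R `^ r^-1)%:E * lipschitz_const r%:E f)%E.
  rewrite mulrA mulrC EFinM lee_pdivrMl//; exact: le_trans H H'.
apply: ge_ereal_sup => _ [[x y] /= xy <-].
apply: (@le_trans _ _ ((d%:R `^ r^-1)%:E * (`|f x - f y| / lp_norm r%:E (x - y))%:E)%E).
  have xy0 : x - y != 0 by rewrite subr_eq0.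
  rewrite -EFinM lee_fin mulrCA; apply: ler_wpM2l => //.
  rewrite -[leLHS]/((maxnorm (x - y))^-1) ler_pdivlMr ?lp_norm_gt0//.
  by rewrite mulrC ler_pdivrMr ?maxnorm_gt0// lp_norm_le_maxnorm.
apply: lee_wpmul2l; first by rewrite lee_fin ltW.
by apply: ereal_sup_ubound; exists (x, y).
Qed.

End maxnorm.

(** * Behaviour of the network far out on a ray *)

Section gradient.
Variables (R : realType) (d N L : nat).
Implicit Types (theta : relu_params R d N L) (ls : seq 'I_L.-1).

(** The Jacobian of ReLU at h applied to v, with derivative 0 at 0. *)
Definition gate n (h v : 'cV[R]_n) : 'cV[R]_n :=
  \col_i (if 0 < h i ord0 then v i ord0 else 0).

Definition nonzero n (h : 'cV[R]_n) := [forall i, h i ord0 != 0].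

Definition dot n (v u : 'cV[R]_n) : R := \sum_i v i ord0 * u i ord0.

Definition act n (h : 'cV[R]_n) : 'cV[R]_n := map_mx (@relu R) h.

(* The biases are ignored: this is the gradient of the bias-free network. *)
Fixpoint grad theta ls (x : 'cV[R]_N) : 'cV[R]_N :=
  if ls is l :: ls' then
    let h := W_inner theta l *m x in
    (W_inner theta l)^T *m gate h (grad theta ls' (act h))
  else (W_last theta)^T.

Fixpoint regular theta ls (x : 'cV[R]_N) : bool :=
  if ls is l :: ls' then
    let h := W_inner theta l *m x in nonzero h && regular theta ls' (act h)
  else true.

Definition tail_net theta ls (y : 'cV[R]_N) : R :=
  (W_last theta *m foldl (fun y l => relu_layer (W_inner theta l) (b_inner theta l) y) y ls
   + b_last theta) ord0 ord0.

Lemma dotDr n (v u w : 'cV[R]_n) : dot v (u + w) = dot v u + dot v w.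
Proof. by rewrite /dot -big_split; apply: eq_bigr => i _; rewrite mxE mulrDr. Qed.

Lemma dot_gate n (h v u : 'cV[R]_n) : dot v (gate h u) = dot (gate h v) u.
Proof.
by apply: eq_bigr => i _; rewrite !mxE; case: ifP; rewrite ?mulr0 ?mul0r.
Qed.

Lemma dot_mulmx m n (W : 'M[R]_(m, n)) v u : dot v (W *m u) = dot (W^T *m v) u.
Proof.
rewrite /dot; under eq_bigr do rewrite mxE mulr_sumr.
rewrite exchange_big; apply: eq_bigr => j _ /=; rewrite mxE mulr_suml.
by apply: eq_bigr => i _; rewrite mxE mulrCA mulrA.
Qed.

Lemma gateD n (h u v : 'cV[R]_n) : gate h (u + v) = gate h u + gate h v.
Proof. by apply/matrixP => i j; rewrite !mxE; case: ifP; rewrite ?addr0. Qed.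

(** For large t the term t h_i outweighs the offset c_i, so the signs are those of h. The output is
    again a large multiple of a fixed vector plus an offset, so the argument iterates; the sum of
    all ratios |c_i|/|h_i| is a threshold valid for every i. *)
Lemma relu_layer_far m n (W : 'M[R]_(m, n)) b x u : nonzero (W *m x) ->
  exists t0 : R, forall t, t0 <= t ->
    relu_layer W b (t *: x + u) = t *: act (W *m x) + gate (W *m x) (W *m u + b).
Proof.
move=> /forallP h0; set h := W *m x in h0 *; set c := W *m u + b.
exists (\sum_i `|c i ord0| / `|h i ord0|) => t tt.
have tc i : `|c i ord0| <= t * `|h i ord0|.
  rewrite -ler_pdivrMr ?normr_gt0//; apply: le_trans tt.
  by rewrite (bigD1 i)//= lerDl sumr_ge0// => k _; rewrite divr_ge0.
apply/matrixP => i j; rewrite (ord1 j).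
have -> : relu_layer W b (t *: x + u) i ord0 = relu (t * h i ord0 + c i ord0).
  by rewrite /relu_layer mulmxDr -scalemxAr -addrA -/h -/c !mxE.
have := tc i; rewrite ler_norml => /andP[tc1 tc2].
rewrite [RHS]mxE [X in _ = X + _]mxE [X in _ = _ * X + _]mxE [X in _ = _ + X]mxE.
have [hi|hi] := ltP 0 (h i ord0).
  rewrite (gtr0_norm hi) in tc1; rewrite /relu (max_r (ltW hi)) max_r//.
  by lra.
have hi' : h i ord0 < 0 by rewrite lt_neqAle h0.
rewrite (ltr0_norm hi') in tc2; rewrite /relu (max_l hi) mulr0 addr0 max_l//; lra.
Qed.

(** A and B are chosen before u and hence cancel in differences; only [t0] depends on u. *)
Lemma tail_net_far theta ls x : regular theta ls x ->
  exists A B : R, forall u, exists t0 : R, forall t, t0 <= t ->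
    tail_net theta ls (t *: x + u) = t * A + B + dot (grad theta ls x) u.
Proof.
elim: ls x => [|l ls IH] x /=.
  move=> _; exists ((W_last theta *m x) ord0 ord0), (b_last theta ord0 ord0) => u.
  exists 0 => t _; rewrite /tail_net /= mulmxDr -scalemxAr.
  have -> : dot (W_last theta)^T u = (W_last theta *m u) ord0 ord0.
    by rewrite mxE; apply: eq_bigr => i _; rewrite mxE.
  by rewrite !mxE addrAC.
move=> /andP[h0 /IH[A [B H]]]; set h := W_inner theta l *m x in h0 H *.
exists A, (B + dot (grad theta ls (act h)) (gate h (b_inner theta l))) => u.
have [t1 H1] := @relu_layer_far _ _ (W_inner theta l) (b_inner theta l) x u h0.
have [t2 H2] := H (gate h (W_inner theta l *m u + b_inner theta l)).
exists (Num.max t1 t2) => t; rewrite ge_max => /andP[/H1 E1 /H2 E2].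
rewrite /tail_net /= E1 -/h -[LHS]/(tail_net theta ls _) E2.
by rewrite gateD dotDr -dot_mulmx -dot_gate; ring.
Qed.

Definition input_gradient theta (x : 'cV[R]_d) : 'cV[R]_d :=
  let h := W_first theta *m x in
  (W_first theta)^T *m gate h (grad theta (enum 'I_L.-1) (act h)).

(** Duality of the sup norm and the l^1 norm: the difference quotient is taken between t x + s and t
    x, with s the sign vector of the gradient. *)
Lemma lipschitz_ge_gradient theta (x : 'cV[R]_d) : (0 < d)%N ->
  nonzero (W_first theta *m x) ->
  regular theta (enum 'I_L.-1) (act (W_first theta *m x)) ->
  ((\sum_j `|input_gradient theta x j ord0|)%:E
    <= lipschitz_const +oo%E (relu_net theta))%E.
Proof.
move=> d0 h0 /tail_net_far[A [B H]]; set h := W_first theta *m x in h0 H *.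
set g := input_gradient theta x.
have far u : exists t0 : R, forall t, t0 <= t -> relu_net theta (t *: x + u) =
   t * A + (B + dot (grad theta (enum 'I_L.-1) (act h)) (gate h (b_first theta)))
     + dot g u.
  have [t1 H1] := @relu_layer_far _ _ (W_first theta) (b_first theta) x u h0.
  have [t2 H2] := H (gate h (W_first theta *m u + b_first theta)).
  exists (Num.max t1 t2) => t; rewrite ge_max => /andP[/H1 E1 /H2 E2].
  rewrite -[LHS]/(tail_net theta _ _) E1 -/h E2.
  by rewrite gateD dotDr /g /input_gradient -dot_mulmx -dot_gate; ring.
(* A zero entry of g gets sign 1, so that all entries of s have modulus 1 and s is nonzero of norm 1
   even when g = 0. *)
pose s : 'cV[R]_d := \col_j (if 0 <= g j ord0 then 1 else - 1).
have [t1 H1] := far s; have [t2 H2] := far 0.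
pose t := Num.max t1 t2.
have := H1 t; rewrite le_max lexx => /(_ isT) E1.
have := H2 t; rewrite le_max lexx orbT => /(_ isT) E2.
have sE j : s j ord0 = if 0 <= g j ord0 then 1 else -1 by rewrite mxE.
have dg : dot g s = \sum_j `|g j ord0|.
  apply: eq_bigr => j _; rewrite sE; case: (boolP (0 <= g j ord0)) => gj.
    by rewrite mulr1 ger0_norm.
  by rewrite mulrN1 ltr0_norm// ltNge.
have dg0 : dot g 0 = 0.
  by apply: big1 => j _; rewrite [X in _ * X]mxE mulr0.
have s1 j : `|s j ord0| = 1 by rewrite sE; case: ifP; rewrite ?normrN normr1.
have ms : maxnorm s = 1.
  apply/eqP; rewrite eq_le; apply/andP; split.
    by apply: maxnorm_le => // j; rewrite s1.
  by rewrite -(s1 (Ordinal d0)) maxnorm_ge.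
apply: ereal_sup_ubound; exists (t *: x + s, t *: x + 0) => /=.
  rewrite (inj_eq (addrI _)); apply/eqP => s0; have := s1 (Ordinal d0).
  by rewrite s0 mxE normr0 => /eqP; rewrite eq_sym oner_eq0.
rewrite E1 E2 dg dg0; congr EFin.
rewrite (_ : t *: x + s - (t *: x + 0) = s); last by rewrite addr0 addrAC subrr add0r.
rewrite -[\big[Num.max/0]_(i < d) _]/(maxnorm s) ms divr1 addr0 addrAC subrr add0r ger0_norm//.
exact: sumr_ge0.
Qed.

End gradient.

(** * Rotating the columns of a weight matrix *)

Section block_rotation.
Variables (R : realType) (K : finType) (sd : K -> R).
Local Notation cube := (@cube R K).
Variables (m n : nat) (e : 'I_m -> 'I_n -> K).
Hypothesis e_inj : forall i j i' j', e i j = e i' j' -> i = i' /\ j = j'.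
Variable sg : R.
Hypothesis sdE : forall i j, sd (e i j) = sg.
Hypothesis sg0 : sg != 0.

Definition block : seq K := flatten (map (col e) (enum 'I_n)).

Definition block_mx (z : cube) : 'M[R]_(m, n) := \matrix_(i, j) z (e i j).

(* phi realizes right multiplication of the block by H and preserves integrals. *)
Definition rotates (H : 'M[R]_n) : Prop := exists phi : cube -> cube,
  [/\ measurable_fun setT phi,
    forall (f : cube -> \bar R) z, measurable_fun setT f -> (forall z, 0 <= f z)%E ->
      gint sd block (f \o phi) z = gint sd block f z,
    forall z k, (forall i j, k != e i j) -> phi z k = z k &
    forall z, block_mx (phi z) = block_mx z *m H].

Lemma mem_block i j : e i j \in block.
Proof.
apply/flattenP; exists (col e j); last exact: mem_col.
by apply: map_f; rewrite mem_enum.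
Qed.

Lemma e_inj_neq i j i' j' : (e i j == e i' j') = (i == i') && (j == j').
Proof.
by apply/eqP/andP => [/e_inj[-> ->]//|[/eqP -> /eqP ->]].
Qed.

Lemma rotates1 : rotates 1%:M.
Proof.
by exists id; split => // z; rewrite mulmx1.
Qed.

Lemma rotatesM H1 H2 : rotates H1 -> rotates H2 -> rotates (H1 *m H2).
Proof.
move=> [p1 [mp1 i1 o1 b1]] [p2 [mp2 i2 o2 b2]].
exists (p2 \o p1); split.
- exact: measurableT_comp mp2 mp1.
- move=> f z mf f0; rewrite -[f \o (p2 \o p1)]/((f \o p2) \o p1) i1.
  + exact: i2.
  + exact: measurableT_comp mf mp2.
  + by move=> y; exact: f0.
- by move=> z k ke; rewrite /= o2// o1.
- by move=> z; rewrite /= b2 b1 mulmxA.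
Qed.

Lemma gint_block_rot2 a b (c s : R) (i : 'I_m) (f : cube -> \bar R) z :
  a != b -> c ^+ 2 + s ^+ 2 = 1 -> c != -1 ->
  measurable_fun setT f -> (forall z, 0 <= f z)%E ->
  gint sd block (f \o rot2 (e i a) (e i b) c s) z = gint sd block f z.
Proof.
move=> ab cs c1 mf f0.
have eab : e i a != e i b by rewrite e_inj_neq eqxx.
have mfr : measurable_fun setT (f \o rot2 (e i a) (e i b) c s).
  exact: (measurableT_comp mf (measurable_rot2 _ _ _ _)).
pose t := rem (e i b) (rem (e i a) block).
have pt : perm_eq block (t ++ [:: e i a; e i b]).
  rewrite perm_sym perm_catC /= perm_sym.
  rewrite (permPl (perm_to_rem (mem_block i a))) perm_cons.
  apply: perm_to_rem; have := mem_block i b.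
  by rewrite (perm_mem (perm_to_rem (mem_block i a))) in_cons eq_sym (negbTE eab).
rewrite (perm_gint sd z mfr (fun y => f0 _) pt) (perm_gint sd z mf f0 pt) !gint_cat.
apply: eq_gint => z' _.
by apply: gint_rot2 => //; rewrite ?sdE.
Qed.

(** Laid out so that right multiplication acts on columns a and b of each row exactly as [rot2]
    does. *)
Definition givens (a b : 'I_n) (c s : R) : 'M[R]_n := \matrix_(i, j)
  (if j == a then if i == a then c else if i == b then s else 0
   else if j == b then if i == a then - s else if i == b then c else 0
   else (i == j)%:R).

Lemma sum2 (F : 'I_n -> R) a b : a != b ->
  (forall k, k != a -> k != b -> F k = 0) -> \sum_k F k = F a + F b.
Proof.
move=> ab F0; rewrite (bigD1 a)//= (bigD1 b) ?(eq_sym b a)//=.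
by rewrite big1 ?addr0// => k /andP[]; exact: F0.
Qed.

Lemma mulmx_givens p (W : 'M[R]_(p, n)) a b c s i j : a != b ->
  (W *m givens a b c s) i j =
  if j == a then c * W i a + s * W i b
  else if j == b then c * W i b - s * W i a else W i j.
Proof.
move=> ab; have ba : (b == a) = false by rewrite eq_sym; exact/negbTE.
rewrite mxE; case: (eqVneq j a) => [->|ja].
  rewrite (sum2 ab); last first.
    by move=> k /negbTE ka /negbTE kb; rewrite mxE eqxx ka kb mulr0.
  by rewrite !mxE !eqxx ba; ring.
case: (eqVneq j b) => [->|jb].
  rewrite (sum2 ab); last first.
    by move=> k /negbTE ka /negbTE kb; rewrite mxE ba eqxx ka kb mulr0.
  by rewrite !mxE !eqxx ba; ring.
rewrite (bigD1 j)//= big1 ?addr0; last first.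
  by move=> k /negbTE kj; rewrite mxE (negbTE ja) (negbTE jb) kj mulr0.
by rewrite mxE (negbTE ja) (negbTE jb) eqxx mulr1.
Qed.

Lemma givens_mul_col (x : 'cV[R]_n) a b c s : a != b ->
  givens a b c s *m x =
  \col_j (if j == a then c * x a ord0 - s * x b ord0
          else if j == b then s * x a ord0 + c * x b ord0 else x j ord0).
Proof.
move=> ab; have ba : (b == a) = false by rewrite eq_sym; exact/negbTE.
apply/matrixP => j k; rewrite (ord1 k) [in LHS]mxE [in RHS]mxE.
case: (eqVneq j a) => [->|ja].
  rewrite (sum2 ab); last first.
    move=> i ia ib; rewrite mxE (negbTE ia) (negbTE ib).
    by rewrite eq_sym (negbTE ia) mul0r.
  by rewrite !mxE !eqxx ba; ring.
case: (eqVneq j b) => [->|jb].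
  rewrite (sum2 ab); last first.
    move=> i ia ib; rewrite mxE (negbTE ia) (negbTE ib).
    by rewrite eq_sym (negbTE ib) mul0r.
  by rewrite !mxE !eqxx ba; ring.
rewrite (bigD1 j)//= big1 ?addr0; last first.
  move=> i ij; rewrite mxE (negbTE ja) (negbTE jb) (eq_sym j i) (negbTE ij).
  by case: ifP => _; rewrite ?mul0r//; case: ifP => _; rewrite mul0r.
by rewrite mxE (negbTE ja) (negbTE jb) eqxx mul1r.
Qed.

Lemma rotates_givens a b c s : a != b -> c ^+ 2 + s ^+ 2 = 1 -> c != -1 ->
  rotates (givens a b c s).
Proof.
move=> ab cs c1; have ba : (b == a) = false by rewrite eq_sym; exact/negbTE.
(* One plane rotation per row; distinct rows involve distinct coordinates and do not interfere. *)
pose phi (t : seq 'I_m) : cube -> cube :=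
  foldr (fun i p => rot2 (e i a) (e i b) c s \o p) id t.
have mphi t : measurable_fun setT (phi t).
  elim: t => [|i t IH]; first exact: measurable_id.
  exact: (measurableT_comp (measurable_rot2 _ _ _ _) IH).
have iphi t (f : cube -> \bar R) z : measurable_fun setT f -> (forall z, 0 <= f z)%E ->
    gint sd block (f \o phi t) z = gint sd block f z.
  elim: t f => [//|i t IH] f mf f0 /=.
  rewrite -[f \o _]/((f \o rot2 (e i a) (e i b) c s) \o phi t) IH.
  - exact: gint_block_rot2.
  - exact: (measurableT_comp mf (measurable_rot2 _ _ _ _)).
  - by move=> y; exact: f0.
have ophi t z k : (forall i j, k != e i j) -> phi t z k = z k.
  by move=> ke; elim: t => //= i t IH; rewrite {1}/rot2 !(negbTE (ke _ _)).
have bphi t z : uniq t -> block_mx (phi t z) =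
    \matrix_(i, j) (if i \in t then (block_mx z *m givens a b c s) i j else z (e i j)).
  elim: t => [|i t IH] /=; first by move=> _; apply/matrixP => i j; rewrite !mxE.
  move=> /andP[it /IH {}IH]; apply/matrixP => i' j; rewrite [LHS]mxE [RHS]mxE in_cons.
  have E i1 j1 : phi t z (e i1 j1) =
      if i1 \in t then (block_mx z *m givens a b c s) i1 j1 else z (e i1 j1).
    by have /matrixP/(_ i1 j1) := IH; rewrite [LHS]mxE [RHS]mxE.
  rewrite {1}/rot2 !e_inj_neq !E (negbTE it).
  case: (eqVneq i' i) => [->|//] /=; rewrite mulmx_givens// (negbTE it).
  by rewrite !mxE.
exists (phi (enum 'I_m)); split => //.
- by move=> f z mf f0; exact: iphi.
- by move=> z k; exact: ophi.
- move=> z; rewrite bphi ?enum_uniq//; apply/matrixP => i j.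
  by rewrite [LHS]mxE mem_enum.
Qed.

(** Plane rotations move the entries of x into position j0 one at a time, by induction on the number
    of nonzero entries elsewhere. Only indices in S are mixed, so squared length over S is
    preserved; this is the part of W^T b that survives the preceding ReLU. *)
Lemma exists_rotation (S : {set 'I_n}) (j0 : 'I_n) (x : 'cV[R]_n) : j0 \in S ->
  0 < x j0 ord0 -> (forall j, j \notin S -> x j ord0 = 0) ->
  exists (H : 'M[R]_n) (r : R), [/\ rotates H, 0 < r,
    H *m x = r *: delta_mx j0 ord0 &
    forall u : 'cV[R]_n, \sum_(j in S) (H^T *m u) j ord0 ^+ 2 = \sum_(j in S) u j ord0 ^+ 2].
Proof.
move=> j0S; have [p] := ubnP #|[set j | (j != j0) && (x j ord0 != 0)]%SET|.
elim: p x => // p IH x; rewrite ltnS => lep xj0 xS.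
have [/eqP|] := posnP #|[set j | (j != j0) && (x j ord0 != 0)]%SET|.
  rewrite cards_eq0 => /eqP H0; exists 1%:M, (x j0 ord0); split => //.
  - exact: rotates1.
  - rewrite mul1mx; apply/matrixP => j k; rewrite (ord1 k) !mxE eqxx andbT.
    have [->|jj0] := eqVneq j j0; first by rewrite mulr1.
    rewrite mulr0; apply/eqP; have : j \notin [set j | (j != j0) && (x j ord0 != 0)]%SET.
      by rewrite H0 inE.
    by rewrite inE jj0 negbK.
  - by move=> u; rewrite trmx1 mul1mx.
move=> /card_gt0P[b]; rewrite inE => /andP[bj0 xb].
have bS : b \in S by apply: contraNT xb => /xS ->.
have j0b : j0 != b by rewrite eq_sym.
pose r := Num.sqrt (x j0 ord0 ^+ 2 + x b ord0 ^+ 2).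
have rr : 0 < x j0 ord0 ^+ 2 + x b ord0 ^+ 2.
  by rewrite ltr_pwDl ?sqr_ge0// exprn_gt0.
have r0 : 0 < r by rewrite sqrtr_gt0.
have r2 : r ^+ 2 = x j0 ord0 ^+ 2 + x b ord0 ^+ 2 by rewrite sqr_sqrtr// ltW.
(* By [givens_mul_col], entry j0 becomes c x_j0 - s x_b = r and entry b becomes 0. Positivity of
   x_j0 gives c > 0, hence an angle different from pi. *)
pose c := x j0 ord0 / r; pose s := - (x b ord0 / r).
have cs : c ^+ 2 + s ^+ 2 = 1.
  by rewrite /c /s sqrrN !exprMn -mulrDl -r2 -exprMn divff ?gt_eqF// expr1n.
have c0 : 0 < c by rewrite divr_gt0.
have c1 : c != -1 by rewrite gt_eqF// (lt_trans _ c0)// ltrN10.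
pose G := givens j0 b c s; pose x' := G *m x.
have x'E : x' = \col_j (if j == j0 then r else if j == b then 0 else x j ord0).
  rewrite /x' /G givens_mul_col//; apply/matrixP => j k; rewrite !mxE.
  case: ifP => _.
    rewrite /c /s mulNr opprK mulrAC [X in _ + X]mulrAC -mulrDl -!expr2 -r2.
    by rewrite expr2 mulfK ?gt_eqF.
  case: ifP => // _; rewrite /c /s; ring.
have [|||H' [r' [rH' r'0 H'x HS]]] := IH x' _ _ _.
- apply: leq_trans lep; apply: proper_card; apply/properP; split.
    apply/fintype.subsetP => j; rewrite !inE x'E mxE => /andP[jj0].
    by rewrite jj0 (negbTE jj0); case: ifP; rewrite ?eqxx.
  by exists b; rewrite !inE ?bj0// x'E mxE (negbTE bj0) !eqxx.
- by rewrite x'E mxE eqxx.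
- move=> j jS; rewrite x'E mxE; case: eqP => [jE|_]; first by rewrite jE j0S in jS.
  by case: eqP => // _; exact: xS.
exists (H' *m G), r'; split => //.
- apply: rotatesM => //; exact: rotates_givens.
- by rewrite -mulmxA.
move=> u; rewrite trmx_mul -mulmxA -(HS u); set v := H'^T *m u.
have GE j : (G^T *m v) j ord0 = if j == j0 then c * v j0 ord0 + s * v b ord0
    else if j == b then c * v b ord0 - s * v j0 ord0 else v j ord0.
  have -> : (G^T *m v) = (v^T *m G)^T by rewrite trmx_mul trmxK.
  by rewrite mxE mulmx_givens// !mxE.
have E (F : 'I_n -> R) : \sum_(j in S) F j =
    F j0 + F b + \sum_(j in S | (j != j0) && (j != b)) F j.
  have bP : (b \in S) && (b != j0) by rewrite bS bj0.
  rewrite (bigD1 j0 j0S)/= (bigD1 b bP)/= addrA; congr (_ + _).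
  by apply: eq_bigl => j; rewrite andbA.
rewrite [LHS]E [RHS]E; congr (_ + _).
  rewrite !GE eqxx (negbTE bj0) eqxx.
  transitivity ((c ^+ 2 + s ^+ 2) * (v j0 ord0 ^+ 2 + v b ord0 ^+ 2)); first by ring.
  by rewrite cs mul1r.
by apply: eq_bigr => j /and3P[_ jj0 jb]; rewrite GE (negbTE jj0) (negbTE jb).
Qed.

End block_rotation.

(** * Propagation through the layers *)

Section measurable_network.
Variables (R : realType) (d N L : nat).
Local Notation K := (param_index d N L).
Local Notation cube := (@cube R K).
Implicit Types (ls : seq 'I_L.-1).

Definition measurable_vec n (F : cube -> 'cV[R]_n) :=
  forall i, measurable_fun setT (fun z => F z i ord0).

Lemma measurable_if_gt0 (X Y : cube -> R) : measurable_fun setT X ->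
  measurable_fun setT Y -> measurable_fun setT (fun z => if 0 < X z then Y z else 0).
Proof.
move=> mX mY.
have mA : measurable [set z : cube | 0 < X z].
  by have := mX measurableT _ (@measurable_gt0 R); rewrite setTI.
rewrite (_ : (fun z => _) = (fun z => \1_[set z : cube | 0 < X z] z * Y z)).
  by apply: measurable_funM => //; exact: measurable_indic.
apply/funext => z; rewrite indicE.
have -> : (z \in [set z : cube | 0 < X z]) = (0 < X z) by apply/idP/idP; rewrite inE.
by case: ifP; rewrite ?mul1r ?mul0r.
Qed.

Lemma measurable_gate n (h v : cube -> 'cV[R]_n) :
  measurable_vec h -> measurable_vec v -> measurable_vec (fun z => gate (h z) (v z)).
Proof.
move=> mh mv i; rewrite (_ : (fun z => _) =
  (fun z => if 0 < h z i ord0 then v z i ord0 else 0)); last first.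
  by apply/funext => z; rewrite mxE.
exact: measurable_if_gt0.
Qed.

Lemma measurable_act n (h : cube -> 'cV[R]_n) :
  measurable_vec h -> measurable_vec (fun z => act (h z)).
Proof.
move=> mh i; rewrite (_ : (fun z => _) = (fun z => Num.max 0 (h z i ord0))); last first.
  by apply/funext => z; rewrite mxE.
by apply: measurable_maxr => //; exact: mh.
Qed.

Lemma measurable_mulmx m n (e : 'I_m -> 'I_n -> K) (W : cube -> 'M[R]_(m, n))
    (x : cube -> 'cV[R]_n) : (forall z i j, W z i j = z (e i j)) ->
  measurable_vec x -> measurable_vec (fun z => W z *m x z).
Proof.
move=> WE mx i; rewrite (_ : (fun z => _) =
  (fun z => \sum_j z (e i j) * x z j ord0)); last first.
  by apply/funext => z; rewrite mxE; apply: eq_bigr => j _; rewrite WE.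
by apply: measurable_sum => j; apply: measurable_funM => //; exact: measurable_coord.
Qed.

Lemma measurable_grad ls (x : cube -> 'cV[R]_N) : measurable_vec x ->
  measurable_vec (fun z => grad (params_of z) ls (x z)).
Proof.
elim: ls x => [|l ls IH] x mx /=.
  move=> i; rewrite (_ : (fun z => _) = (fun z : cube => z (inl (inr (inr i))))).
    exact: measurable_coord.
  by apply/funext => z; rewrite !mxE.
have mh : measurable_vec (fun z => W_inner (params_of z) l *m x z).
  apply: (measurable_mulmx (e := fun i j => inl (inr (inl (l, i, j))))) => // z i j.
  by rewrite mxE.
apply: (measurable_mulmx (e := fun i j => inl (inr (inl (l, j, i))))).
  by move=> z i j; rewrite !mxE.
by apply: measurable_gate => //; apply: IH; exact: measurable_act.
Qed.

Lemma measurable_nonzero n (h : cube -> 'cV[R]_n) : measurable_vec h ->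
  measurable [set z : cube | nonzero (h z)].
Proof.
move=> mh; rewrite [X in measurable X](_ : _ =
    \big[setI/setT]_(i : 'I_n) [set z : cube | h z i ord0 != 0]).
  apply: bigsetI_measurable => i _.
  have := mh i measurableT (~` [set 0]) (measurableC (measurable_set1 _)).
  rewrite setTI; congr measurable; apply/seteqP; split => z /=; first by move/eqP.
  by move/eqP.
apply/seteqP; split => z /=.
  move=> /forallP hz; apply: (big_ind (fun B : set cube => B z)) => // i _; exact: hz.
by move=> H; apply/forallP => i; move: H; rewrite (bigD1 i)//= => -[].
Qed.

Lemma measurable_regular ls (x : cube -> 'cV[R]_N) : measurable_vec x ->
  measurable [set z : cube | regular (params_of z) ls (x z)].
Proof.
elim: ls x => [|l ls IH] x mx.
  by rewrite (_ : [set z : cube | _] = setT)//; apply/seteqP; split.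
have mh : measurable_vec (fun z => W_inner (params_of z) l *m x z).
  apply: (measurable_mulmx (e := fun i j => inl (inr (inl (l, i, j))))) => // z i j.
  by rewrite mxE.
rewrite [X in measurable X](_ : _ =
  [set z : cube | nonzero (W_inner (params_of z) l *m x z)] `&`
  [set z : cube | regular (params_of z) ls (act (W_inner (params_of z) l *m x z))]).
  apply: measurableI; first exact: measurable_nonzero.
  by apply: IH; exact: measurable_act.
by apply/seteqP; split => z /= => [/andP[]//|[-> ->]].
Qed.

Definition nrm2 n (v : 'cV[R]_n) : R := \sum_i v i ord0 ^+ 2.

Lemma measurable_nrm2 n (v : cube -> 'cV[R]_n) : measurable_vec v ->
  measurable_fun setT (fun z => nrm2 (v z)).
Proof. by move=> mv; apply: measurable_sum => i; apply: measurable_funX; exact: mv. Qed.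

Lemma measurable_lt (X Y : cube -> R) : measurable_fun setT X -> measurable_fun setT Y ->
  measurable [set z : cube | X z < Y z].
Proof.
move=> mX mY; have := measurable_funB mY mX measurableT (@measurable_gt0 R).
by rewrite setTI; congr measurable; apply/seteqP; split => z /=; rewrite subr_gt0.
Qed.

Lemma measurable_le (X Y : cube -> R) : measurable_fun setT X -> measurable_fun setT Y ->
  measurable [set z : cube | X z <= Y z].
Proof.
move=> mX mY; have := measurableC (measurable_lt mY mX).
by congr measurable; apply/seteqP; split => z /=; rewrite leNgt => /negP.
Qed.

Definition npos n (x : 'cV[R]_n) : R := \sum_i (0 < x i ord0)%R%:R.

Lemma measurable_npos n (x : cube -> 'cV[R]_n) : measurable_vec x ->
  measurable_fun setT (fun z => npos (x z)).
Proof.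
move=> mx; apply: measurable_sum => i.
rewrite (_ : (fun z => _) = (fun z => if 0 < x z i ord0 then 1 else 0)).
  by apply: measurable_if_gt0.
by apply/funext => z; case: ifP.
Qed.

(** Here x plays the output of the preceding ReLU. Gating by it is gating by its pre-activation
    ([gate_act]), so the vector measured is the one back-propagated through that ReLU as well. *)
Definition bad ls (tau : R) (x : cube -> 'cV[R]_N) : set cube :=
  [set z : cube | ~~ regular (params_of z) ls (x z) \/
    nrm2 (gate (x z) (grad (params_of z) ls (x z))) < tau].

Lemma measurable_bad ls tau (x : cube -> 'cV[R]_N) : measurable_vec x ->
  measurable (bad ls tau x).
Proof.
move=> mx; rewrite (_ : bad ls tau x =
    ~` [set z : cube | regular (params_of z) ls (x z)] `|`
    [set z : cube | nrm2 (gate (x z) (grad (params_of z) ls (x z))) < tau]).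
  apply: measurableU; first by apply: measurableC; exact: measurable_regular.
  apply: measurable_lt => //; apply: measurable_nrm2; apply: measurable_gate => //.
  exact: measurable_grad.
by apply/seteqP; split => z /= [/negP ?|?]; by [left|right].
Qed.

Lemma gate_act n (h v : 'cV[R]_n) : gate (act h) v = gate h v.
Proof.
by apply/matrixP => i j; rewrite !mxE /relu lt_max ltxx.
Qed.

Lemma npos_act n (h : 'cV[R]_n) : npos (act h) = npos h.
Proof. by apply: eq_bigr => i _; rewrite mxE /relu lt_max ltxx. Qed.

(** Both quantities are functions of the last weights and of the layers in ls alone, so they stay
    fixed while another layer is integrated. *)
Lemma eq_grad (t1 t2 : relu_params R d N L) ls x :
  (forall l, l \in ls -> W_inner t1 l = W_inner t2 l) -> W_last t1 = W_last t2 ->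
  grad t1 ls x = grad t2 ls x /\ regular t1 ls x = regular t2 ls x.
Proof.
move=> + WL; elim: ls x => [|l ls IH] x WI /=; first by rewrite WL.
rewrite WI ?mem_head//; have [|-> ->//] := IH (act (W_inner t2 l *m x)).
by move=> l' l'ls; apply: WI; rewrite in_cons l'ls orbT.
Qed.

End measurable_network.

(** * Splitting a matrix into groups of columns *)

Section blocks.
Variables (K : finType) (I J : finType) (e : I -> J -> K).

Lemma perm_cols (S : {set J}) : perm_eq (flatten (map (col e) (enum J)))
  (flatten (map (col e) (enum (~: S))) ++ flatten (map (col e) (enum S))).
Proof.
rewrite -flatten_cat -map_cat; apply: perm_flatten; apply: perm_map.
have -> : enum S = [seq j <- enum J | j \in S].
  by rewrite {1}/enum_mem enumT.
have -> : enum (~: S) = [seq j <- enum J | predC (mem S) j].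
  by rewrite {1}/enum_mem enumT; apply: eq_filter => j; rewrite /= inE.
by rewrite perm_sym perm_catC perm_filterC.
Qed.

End blocks.

Section subsets_of_coordinates.
Variables (R : realType) (K : finType) (sd : K -> R).
Local Notation cube := (@cube R K).

Lemma pr_sub_le (s u t : seq K) (A : set cube) z (c : R) : measurable A ->
  perm_eq s (u ++ t) -> (forall z, pr sd t A z <= c%:E)%E -> (pr sd s A z <= c%:E)%E.
Proof. by move=> mA st H; rewrite (pr_perm sd z mA st); apply: pr_cat_le. Qed.

Lemma pr_le_const (s : seq K) (A B : set cube) z (c : R) : measurable A -> measurable B ->
  (forall z', agree s z z' -> A z' -> B z') -> (pr sd s B z <= c%:E)%E ->
  (pr sd s A z <= c%:E)%E.
Proof. by move=> mA mB AB; apply: le_trans; exact: pr_le. Qed.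

Lemma pr_none (s : seq K) (A : set cube) z (c : R) : measurable A -> 0 <= c ->
  (forall z', agree s z z' -> ~ A z') -> (pr sd s A z <= c%:E)%E.
Proof.
move=> mA c0 H; apply: (pr_le_const (B := set0)) => //.
rewrite /pr (_ : (fun z => _) = fun=> 0%E); first by rewrite gint_cst// lee_fin.
by apply/funext => z'; rewrite indic0.
Qed.

End subsets_of_coordinates.

(** * Recursion over the layers *)

Section recursion.
Variables (R : realType) (d N L : nat).
Local Notation K := (param_index d N L).
Local Notation cube := (@cube R K).
Variable sd : K -> R.
Variable sg : R.
Hypothesis sg0 : sg != 0.

Definition inner_index (l : 'I_L.-1) (i j : 'I_N) : K := inl (inr (inl (l, i, j))).
(** The dummy row index makes the last weights a matrix with one row, so that the column estimates
    apply to them. *)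
Definition last_index (i : 'I_1) (j : 'I_N) : K := inl (inr (inr j)).
Definition first_index (i : 'I_N) (j : 'I_d) : K := inl (inl (i, j)).

Definition tail_coords (ls : seq 'I_L.-1) : seq K :=
  flatten (map (fun l => block (inner_index l)) ls) ++ block last_index.

Hypothesis sd_inner : forall l i j, sd (inner_index l i j) = sg.
Hypothesis sd_first : forall i j, sd (first_index i j) = sg.
Hypothesis sd_last : forall i j, sd (last_index i j) = 1.

Lemma inner_inj l i j i' j' : inner_index l i j = inner_index l i' j' -> i = i' /\ j = j'.
Proof. by case. Qed.

Lemma last_inj i j i' j' : last_index i j = last_index i' j' -> i = i' /\ j = j'.
Proof. by case=> ->; rewrite (ord1 i) (ord1 i'). Qed.

Lemma first_inj i j i' j' : first_index i j = first_index i' j' -> i = i' /\ j = j'.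
Proof. by case. Qed.

Lemma mem_blockP m n (e : 'I_m -> 'I_n -> K) k :
  reflect (exists i j, k = e i j) (k \in block e).
Proof.
apply: (iffP flattenP) => [[_ /mapP[j _ ->] /mapP[i _ ->]]|[i [j ->]]].
  by exists i, j.
by exists (col e j); [apply: map_f; rewrite mem_enum|exact: mem_col].
Qed.

Lemma mem_tail_coords ls k : k \in tail_coords ls ->
  (exists l i j, l \in ls /\ k = inner_index l i j) \/ exists i j, k = last_index i j.
Proof.
rewrite mem_cat => /orP[/flattenP[_ /mapP[l lls ->] /mem_blockP[i [j ->]]]|].
  by left; exists l, i, j.
by move=> /mem_blockP[i [j ->]]; right; exists i, j.
Qed.

(** [mm] bounds the number of active neurons from below and [rho] is the factor kept of the squared
    norm per layer. [l1] and [y] are Chernoff parameters, for counting signs and for the chi-square;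
    [d1] and [d2] are the corresponding failure probabilities. In [d2E], k counts the active columns
    without j0, whence k + 1 against [mm]. *)
Variables (mm rho l1 y d1 d2 : R).
Hypotheses (mm0 : 0 < mm) (l10 : 0 <= l1) (y0 : 0 <= y) (rho0 : 0 < rho) (N0 : (0 < N)%N)
  (d10 : 0 <= d1) (d20 : 0 <= d2) (sg2 : sg ^+ 2 = 2 / N%:R)
  (d1E : expR (l1 * mm) * ((1 + expR (- l1)) / 2) ^+ N <= d1)
  (d2E : forall k : nat, mm <= k.+1%:R ->
     expR (y * (N%:R / 4) * rho) * (Num.sqrt (1 + y))^-1 ^+ k <= d2).

(* Threshold for the squared norm of the vector back-propagated through n layers. *)
Definition tau n : R := N%:R / 2 * rho ^+ n.+1.

Lemma tau_gt0 n : 0 < tau n.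
Proof. by rewrite /tau mulr_gt0 ?exprn_gt0// divr_gt0// ltr0n. Qed.

Lemma pr_chisq_tau (J : finType) (e : 'I_N -> J -> K) (S : {set J}) (v : 'cV[R]_N) n z :
  (forall i j i' j', e i j = e i' j' -> i = i' /\ j = j') ->
  (forall i j, sd (e i j) = sg) -> mm <= #|S|.+1%:R -> tau n <= nrm2 v ->
  (pr sd (flatten (map (col e) (enum S)))
    [set z | (\sum_(j <- enum S) coldot e (fun i => v i ord0) z j ^+ 2 < tau n.+1)%R] z
  <= d2%:E)%E.
Proof.
move=> ei sde mS tv.
have t0 := tau_gt0 n.
(* Chosen so that 2 l sg^2 [tau n] = y, with sg^2 = 2/N; a longer v only improves the bound. *)
pose l := y * (N%:R / 4) / tau n.
have l0 : 0 <= l by rewrite !mulr_ge0// ?invr_ge0 ?ltW.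
apply: (le_trans (pr_chisq ei sde sg0 (fun i => v i ord0) _ z (enum_uniq _) l0)).
rewrite lee_fin; apply: le_trans (d2E mS); rewrite cardE.
have -> : l * tau n.+1 = y * (N%:R / 4) * rho.
  have tS : tau n.+1 = rho * tau n by rewrite /tau exprS; ring.
  by rewrite tS /l mulrCA mulfVK ?gt_eqF// mulrC.
rewrite ler_wpM2l ?expR_ge0//; apply: lerXn2r.
- by rewrite nnegrE invr_ge0 sqrtr_ge0.
- by rewrite nnegrE invr_ge0 sqrtr_ge0.
rewrite lef_pV2 ?posrE ?sqrtr_gt0; last 2 first.
- rewrite ltr_pwDl// mulr_ge0//; last by apply: sumr_ge0 => i _; exact: sqr_ge0.
  by rewrite mulr_ge0 ?sqr_ge0// mulr_ge0.
- by rewrite ltr_pwDl.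
rewrite ler_wsqrtr// lerD2l sg2.
apply: (@le_trans _ _ (2 * l * (2 / N%:R) * tau n)).
  have Nn : (N%:R : R) != 0 by rewrite pnatr_eq0 -lt0n.
  rewrite /l le_eqVlt; apply/orP; left; apply/eqP; field.
  by rewrite Nn gt_eqF.
apply: ler_wpM2l; last exact: tv.
by apply: mulr_ge0; [exact: mulr_ge0|rewrite divr_ge0 ?ler0n].
Qed.

Lemma pr_column_bad n (e : 'I_N -> 'I_n -> K) j0 z :
  (forall i j i' j', e i j = e i' j' -> i = i' /\ j = j') ->
  (forall i j, sd (e i j) = sg) ->
  (pr sd (col e j0) [set z : cube | ~~ nonzero (matrix.col j0 (block_mx e z)) \/
     (npos (matrix.col j0 (block_mx e z)) < mm)%R] z <= d1%:E)%E.
Proof.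
move=> ei sde; pose h (z : cube) := matrix.col j0 (block_mx e z).
have hE z' i : h z' i ord0 = z' (e i j0) by rewrite !mxE.
have mh : measurable_vec h.
  by move=> i; rewrite (_ : (fun z => _) = (fun z => z (e i j0)));
    [exact: measurable_coord|apply/funext => z'; rewrite hE].
have mz : measurable [set z | ~~ nonzero (h z)].
  have := measurableC (measurable_nonzero mh); congr measurable.
  by apply/seteqP; split => t /= /negP.
have mp : measurable [set z | npos (h z) < mm].
  by apply: measurable_lt => //; exact: measurable_npos.
have -> : [set z | ~~ nonzero (matrix.col j0 (block_mx e z)) \/
     npos (matrix.col j0 (block_mx e z)) < mm] =
    [set z | ~~ nonzero (h z)] `|` [set z | npos (h z) < mm].
  by apply/seteqP; split.
apply: (le_trans (@pr_le2 _ _ sd (col e j0) _ [set z | ~~ nonzero (h z)]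
  [set z | npos (h z) < mm] z _ mz mp _)); first exact: measurableU.
  by move=> z' _.
rewrite [X in (X + _)%E](_ : _ = 0%E); last first.
  have H0 := @pr_some_zero _ _ sd (col e j0) z (col_uniq ei j0) _.
  apply/eqP; rewrite eq_le pr_ge0 andbT -H0; last by move=> _ /mapP[i _ ->]; rewrite sde.
  apply: pr_le => //.
    rewrite (_ : [set z0 | _] = [set z | ~~ nonzero (h z)])//.
    apply/seteqP; split => t /=.
      move=> [_ /mapP[i _ ->]] ti; apply/forallPn; exists i.
      by rewrite hE ti eqxx.
    move=> /forallPn[i]; rewrite hE negbK => /eqP ti.
    by exists (e i j0); [exact: mem_col|].
  move=> t _ /= /forallPn[i]; rewrite hE negbK => /eqP ti.
  by exists (e i j0); [exact: mem_col|].
rewrite add0e.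
have := pr_few_positive ei sde sg0 j0 mm z l10; rewrite card_ord.
rewrite (_ : [set z | _] = [set z | npos (h z) < mm]); last first.
  have E t : npos (h t) = \sum_i (0 < t (e i j0))%R%:R.
    by apply: eq_bigr => i _; rewrite hE.
  by apply/seteqP; split => t /=; rewrite E.
by move=> /le_trans; apply; rewrite lee_fin.
Qed.

Section layer.
Variables (n : nat) (e : 'I_N -> 'I_n -> K) (j0 : 'I_n) (ls : seq 'I_L.-1) (r B : R).
Hypotheses (ei : forall i j i' j', e i j = e i' j' -> i = i' /\ j = j')
  (sde : forall i j, sd (e i j) = sg) (e_tail : forall i j, e i j \notin tail_coords ls)
  (e_grad : forall (z z' : cube), agree (block e) z z' -> forall x,
     grad (params_of z) ls x = grad (params_of z') ls x) (r0 : 0 < r)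
  (B0 : 0 <= B)
  (IH : forall x : 'cV[R]_N, (forall j, 0 <= x j ord0) -> mm <= npos x -> forall z,
    (pr sd (tail_coords ls) (bad ls (tau (size ls)) (fun=> x)) z <= B%:E)%E).

(** The value of W x after the rotation, which has turned x into r times the basis vector j0. *)
Definition preact (z : cube) : 'cV[R]_N := r *: matrix.col j0 (block_mx e z).

Definition backward (z : cube) : 'cV[R]_N :=
  gate (preact z) (grad (params_of z) ls (act (preact z))).

Lemma preactE z i : preact z i ord0 = r * z (e i j0).
Proof. by rewrite !mxE. Qed.

Lemma measurable_preact : measurable_vec preact.
Proof.
move=> i; rewrite (_ : (fun z => _) = (fun z => r * z (e i j0))).
  by apply: measurable_funM => //; exact: measurable_coord.
by apply/funext => z; rewrite preactE.
Qed.

Lemma measurable_backward : measurable_vec backward.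
Proof.
apply: measurable_gate; first exact: measurable_preact.
by apply: measurable_grad; apply: measurable_act; exact: measurable_preact.
Qed.

Lemma npos_preact z : npos (preact z) = npos (matrix.col j0 (block_mx e z)).
Proof. by apply: eq_bigr => i _; rewrite preactE pmulr_rgt0// !mxE. Qed.

Lemma nonzero_preact z : nonzero (preact z) = nonzero (matrix.col j0 (block_mx e z)).
Proof.
by apply: eq_forallb => i; rewrite preactE mulf_eq0 gt_eqF// !mxE.
Qed.

(* Up to the failure of the column j0 and of the remaining layers, only A3 is left. *)
Lemma pr_layer (F A3 : set cube) (c3 : R) z : measurable F -> measurable A3 ->
  (forall z, F z -> nonzero (preact z) -> mm <= npos (preact z) ->
     regular (params_of z) ls (act (preact z)) -> tau (size ls) <= nrm2 (backward z) ->
     A3 z) ->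
  (forall z, pr sd (block e ++ tail_coords ls) A3 z <= c3%:E)%E ->
  (pr sd (block e ++ tail_coords ls) F z <= (d1 + B + c3)%:E)%E.
Proof.
move=> mF mA3 FA3 H3; set s := block e ++ tail_coords ls.
pose A1 : set cube := [set z | ~~ nonzero (matrix.col j0 (block_mx e z)) \/
     npos (matrix.col j0 (block_mx e z)) < mm].
pose A2 : set cube := [set z | mm <= npos (preact z)] `&`
  bad ls (tau (size ls)) (fun z => act (preact z)).
have mcol : measurable_vec (fun z : cube => matrix.col j0 (block_mx e z)).
  move=> i; rewrite (_ : (fun z => _) = (fun z : cube => z (e i j0))).
    exact: measurable_coord.
  by apply/funext => z'; rewrite !mxE.
have mA1 : measurable A1.
  rewrite (_ : A1 = ~` [set z : cube | nonzero (matrix.col j0 (block_mx e z))] `|`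
    [set z : cube | npos (matrix.col j0 (block_mx e z)) < mm]).
    apply: measurableU; first by apply: measurableC; exact: measurable_nonzero.
    by apply: measurable_lt => //; exact: measurable_npos.
  by apply/seteqP; split => t /= [/negP ?|?]; by [left|right].
have mA2 : measurable A2.
  apply: measurableI.
    by apply: measurable_le => //; apply: measurable_npos; exact: measurable_preact.
  by apply: measurable_bad; apply: measurable_act; exact: measurable_preact.
have H1 : (pr sd s A1 z <= d1%:E)%E.
  apply: (@pr_sub_le _ _ sd s (flatten (map (col e) (enum (~: [set j0])%SET)) ++ tail_coords ls)
    (col e j0)) => //; last by move=> z'; exact: pr_column_bad.
  rewrite /s /block.
  apply: perm_trans (_ : perm_eq _ ((flatten (map (col e) (enum (~: [set j0])%SET)) ++
    flatten (map (col e) (enum [set j0]%SET))) ++ tail_coords ls)) _.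
    by rewrite perm_cat2r; exact: perm_cols.
  by rewrite enum_set1 /= cats0 perm_catAC.
have H2 : (pr sd s A2 z <= B%:E)%E.
  apply: pr_cat_le => // z' _.
  have pc z1 : agree (tail_coords ls) z' z1 -> preact z1 = preact z'.
    move=> ag; apply/matrixP => i j; rewrite (ord1 j) !preactE; congr (_ * _).
    by rewrite ag.
  (* The block is frozen here, so the input of the remaining layers is a fixed nonnegative vector
     and the uniform bound [IH] applies. If too few entries are positive, A2 is empty. *)
  have [mz|mz] := leP mm (npos (preact z')).
    have := IH (x := act (preact z')) _ _ z'; rewrite npos_act => H.
    apply: pr_le_const (H _ mz) => //; first by apply: measurable_bad => i.
      by move=> z1 ag [_]; rewrite /bad/= (pc _ ag).
    by move=> j; rewrite mxE /relu le_max lexx.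
  by apply: pr_none => // z1 ag []; rewrite /= (pc _ ag) leNgt mz.
apply: (le_trans (@pr_le2 _ _ sd s F (A1 `|` A2) A3 z mF (measurableU _ _ mA1 mA2) mA3 _)).
  move=> z' _ Fz; have [h0|h0] := boolP (nonzero (preact z')); last first.
    by left; left; left; rewrite -nonzero_preact.
  have [mz|mz] := leP mm (npos (preact z')); last first.
    by left; left; right; rewrite -npos_preact.
  have [rg|rg] := boolP (regular (params_of z') ls (act (preact z'))); last first.
    by left; right; split => //; left.
  have [tb|tb] := leP (tau (size ls)) (nrm2 (backward z')).
    by right; exact: FA3.
  by left; right; split => //; right; rewrite gate_act.
rewrite !EFinD; apply: leeD; last exact: H3.
apply: le_trans (leeD H1 H2).
by apply: pr_le2 => //; exact: measurableU.
Qed.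

(* The columns in S do not contain j0, so the vector [backward z] is constant while
   they are integrated. *)
Lemma pr_backward (S : {set 'I_n}) (P : cube -> set cube) (A3 : set cube) (c3 : R) z :
  j0 \notin S -> measurable A3 -> 0 <= c3 ->
  (forall z, measurable (P z)) ->
  (forall z z', agree (flatten (map (col e) (enum S))) z z' -> A3 z' ->
     tau (size ls) <= nrm2 (backward z') -> backward z = backward z' -> P z z') ->
  (forall z, A3 z -> tau (size ls) <= nrm2 (backward z)) ->
  (forall z, (tau (size ls) <= nrm2 (backward z))%R ->
     pr sd (flatten (map (col e) (enum S))) (P z) z <= c3%:E)%E ->
  (pr sd (block e ++ tail_coords ls) A3 z <= c3%:E)%E.
Proof.
move=> j0S mA3 c30 mP AP At HP; set t := flatten (map (col e) (enum S)).
apply: (@pr_sub_le _ _ sd _ (tail_coords ls ++ flatten (map (col e) (enum (~: S)))) t) => //.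
  rewrite perm_catC -catA perm_cat2l; exact: perm_cols.
move=> z'.
have tP k : k \in t -> exists i j, j \in S /\ k = e i j.
  move=> /flattenP[_ /mapP[j jS ->] /mapP[i _ ->]]; exists i, j; split => //.
  by rewrite mem_enum in jS.
have bc z1 : agree t z' z1 -> backward z' = backward z1.
  move=> ag; have pc : preact z' = preact z1.
    apply/matrixP => i j; rewrite (ord1 j) !preactE; congr (_ * _); apply: ag.
    apply/negP => /tP[i' [j' [j'S /ei[_ jj]]]]; by rewrite jj j'S in j0S.
  rewrite /backward pc; congr gate; apply: e_grad => k kb; apply: ag.
  apply/negP => /tP[i' [j' [_ kE]]]; move: kb; rewrite kE => /mem_blockP; apply.
  by exists i', j'.
(* [backward] does not change under integration over t, so this comparison is decided at z'; in the
   second case [A3] cannot occur. *)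
have [tb|tb] := leP (tau (size ls)) (nrm2 (backward z')).
  apply: pr_le_const (HP _ tb) => // z1 ag A3z; apply: AP => //; last exact: bc.
  exact: At.
by apply: pr_none => // z1 ag /At; rewrite -(bc _ ag) leNgt tb.
Qed.

End layer.

Lemma nrm2_gate n (x v : 'cV[R]_n) :
  nrm2 (gate x v) = \sum_(j in [set j | 0 < x j ord0]%SET) v j ord0 ^+ 2.
Proof.
rewrite [RHS]big_mkcond; apply: eq_bigr => j _; rewrite mxE inE.
by case: ifP => _ //; rewrite expr0n.
Qed.

Lemma npos_card n (x : 'cV[R]_n) : npos x = #|[set j | 0 < x j ord0]%SET|%:R.
Proof.
rewrite -sum1_card natr_sum [RHS]big_mkcond; apply: eq_bigr => j _; rewrite inE.
by case: ifP.
Qed.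

(** The last weights have variance 1, so their squared norm over supp x is a plain chi-square; the
    Chernoff parameter y/2 gives 1 + y under the root, as in the inner layers. *)
Lemma pr_tail_nil (x : 'cV[R]_N) z : mm <= npos x ->
  (pr sd (tail_coords [::]) (bad [::] (tau 0) (fun=> x)) z <= d2%:E)%E.
Proof.
move=> mx; set S := [set j | 0 < x j ord0]%SET.
have mb : measurable (bad [::] (tau 0) (fun=> x) : set cube) by apply: measurable_bad => i.
apply: (pr_sub_le z mb (perm_cols last_index S)) => z'.
pose A : set cube := [set z | (\sum_(j <- enum S)
  coldot last_index (fun=> 1%R) z j ^+ 2 < tau 0)%R].
apply: (pr_le_const (B := A)) => //.
- by apply: measurable_sum_lt => j; exact: measurable_coldot_sqr.
- move=> z1 _ [//|]; rewrite /A/= nrm2_gate big_enum/=.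
  rewrite (eq_bigr (fun j => coldot last_index (fun=> 1%R) z1 j ^+ 2))// => j _.
  by rewrite /coldot big_ord1 mul1r !mxE.
have y2 : 0 <= y / 2 by rewrite divr_ge0.
apply: (le_trans (pr_chisq last_inj sd_last (oner_neq0 _) (fun=> 1) _ z' (enum_uniq _) y2)).
rewrite lee_fin big_ord1 !expr1n !mulr1.
have -> : 1 + 2 * (y / 2) = 1 + y by lra.
have -> : y / 2 * tau 0 = y * (N%:R / 4) * rho by rewrite /tau expr1; lra.
rewrite -cardE; apply: d2E; apply: (le_trans mx).
by rewrite npos_card ler_nat leqnSn.
Qed.

(** With the coordinates s frozen outside, invariance of the integral over the single block is
    enough. *)
Lemma pr_rotate (s : seq K) (l : 'I_L.-1) (phi : cube -> cube) (A : set cube) z :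
  measurable_fun setT phi ->
  (forall (f : cube -> \bar R) z, measurable_fun setT f -> (forall z, 0 <= f z)%E ->
      gint sd (block (inner_index l)) (f \o phi) z = gint sd (block (inner_index l)) f z) ->
  measurable A ->
  pr sd (block (inner_index l) ++ s) A z = pr sd (block (inner_index l) ++ s) (phi @^-1` A) z.
Proof.
move=> mphi inv mA.
have mpA : measurable (phi @^-1` A) by rewrite -[_ @^-1` _]setTI; exact: mphi.
have pc : perm_eq (block (inner_index l) ++ s) (s ++ block (inner_index l)).
  by apply/permPl; exact: perm_catC.
rewrite (pr_perm sd z mA pc) (pr_perm sd z mpA pc) /pr !gint_cat.
apply: eq_gint => z' _; rewrite -inv.
- by congr gint; apply/funext => z1; rewrite /= !indicE;
    congr ((nat_of_bool _)%:R%:E); apply/idP/idP; rewrite !inE.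
- exact: measurable_indicE.
- by move=> z1; exact: indicE_ge0.
Qed.

Lemma block_inner l (z : cube) : W_inner (params_of z) l = block_mx (inner_index l) z.
Proof. by apply/matrixP => i j; rewrite !mxE. Qed.

Lemma coldot_mulmx n (e : 'I_N -> 'I_n -> K) (z : cube) (b : 'cV[R]_N) j :
  coldot e (fun i => b i ord0) z j = ((block_mx e z)^T *m b) j ord0.
Proof.
by rewrite mxE; apply: eq_bigr => i _; rewrite !mxE mulrC.
Qed.

(** Each layer adds [d1] for its column j0 and [d2] for its other active columns. Stating the bound
    for every deterministic x lets the induction apply to the random output of a layer, which is
    frozen at that stage. *)
Lemma pr_bad ls (x : 'cV[R]_N) z : uniq ls -> (forall j, 0 <= x j ord0) -> mm <= npos x ->
  (pr sd (tail_coords ls) (bad ls (tau (size ls)) (fun=> x)) z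
    <= ((d1 + d2) * (size ls).+1%:R)%:E)%E.
Proof.
elim: ls x z => [|l ls IH] x z.
  move=> _ _ mx; apply: (le_trans (pr_tail_nil z mx)).
  by rewrite lee_fin mulr1 lerDr.
move=> /= /andP[lls us] x0 mx.
set S := [set j | 0 < x j ord0]%SET.
have /card_gt0P[j0 j0S] : (0 < #|S|)%N.
  by rewrite -(@ltr0n R) -npos_card (lt_le_trans mm0).
have xj0 : 0 < x j0 ord0 by move: j0S; rewrite inE.
have xS j : j \notin S -> x j ord0 = 0.
  by rewrite inE -leNgt => xj; apply/eqP; rewrite eq_le xj x0.
have [H [r [[phi [mphi inv out bphi]] r0 Hx HS]]] :=
  exists_rotation (@inner_inj l) (sd_inner l) sg0 j0S xj0 xS.
set e := inner_index l.
have sE : tail_coords (l :: ls) = block e ++ tail_coords ls by rewrite /tail_coords /= catA.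
have mb : measurable (bad (l :: ls) (tau (size ls).+1) (fun=> x) : set cube).
  by apply: measurable_bad => i.
rewrite sE (pr_rotate _ z mphi inv mb).
have etail i j : e i j \notin tail_coords ls.
  apply/negP => /mem_tail_coords[[l' [i' [j' [l'ls]]]]|[i' [j']]] //.
  by case=> ll' _ _; rewrite ll' l'ls in lls.
(* As l is not in ls, altering the block of layer l, by [phi] in particular, leaves the later layers
   unchanged. *)
have same (z1 z2 : cube) : (forall k, (forall i j, k != e i j) -> z1 k = z2 k) -> forall y,
    grad (params_of z1) ls y = grad (params_of z2) ls y /\
    regular (params_of z1) ls y = regular (params_of z2) ls y.
  move=> z12 y1; apply: eq_grad => [l' l'ls|].
    apply/matrixP => i j; rewrite !mxE; apply: z12 => i' j'.
    by apply/eqP => -[ll' _ _]; rewrite -ll' l'ls in lls.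
  by apply/matrixP => i j; rewrite !mxE; apply: z12.
have egrad (z1 z2 : cube) : agree (block e) z1 z2 -> forall y,
    grad (params_of z1) ls y = grad (params_of z2) ls y.
  move=> ag y1; apply: (same _ _ _ y1).1 => k ke; apply: ag.
  by apply/negP => /mem_blockP[i [j kE]]; have := ke i j; rewrite kE eqxx.
set B := (d1 + d2) * (size ls).+1%:R.
have B0 : 0 <= B by rewrite mulr_ge0// addr_ge0.
have IH' (x1 : 'cV[R]_N) : (forall j, 0 <= x1 j ord0) -> mm <= npos x1 -> forall z,
    (pr sd (tail_coords ls) (bad ls (tau (size ls)) (fun=> x1)) z <= B%:E)%E.
  by move=> ? ? z1; exact: IH.
pose bw := backward e j0 ls r.
pose S' := (S :\ j0)%SET.
pose X (z : cube) (b : 'cV[R]_N) : R := \sum_(j <- enum S') coldot e (fun i => b i ord0) z j ^+ 2.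
have mX b : measurable_fun setT (fun z => X z b).
  by apply: measurable_sum => j; exact: measurable_coldot_sqr.
have mbw : measurable_vec bw by exact: measurable_backward.
have mXb : measurable_fun setT (fun z => X z (bw z)).
  apply: measurable_sum => j; apply: measurable_funX; apply: measurable_sum => i.
  by apply: measurable_funM; [exact: mbw|exact: measurable_coord].
pose A3 : set cube := [set z | tau (size ls) <= nrm2 (bw z)] `&`
  [set z | X z (bw z) < tau (size ls).+1].
have mA3 : measurable A3.
  apply: measurableI; last exact: measurable_lt.
  by apply: measurable_le => //; exact: measurable_nrm2.
have -> : (d1 + d2) * (size ls).+2%:R = d1 + B + d2 by rewrite /B -[in LHS]natr1; ring.
apply: (pr_layer (@inner_inj l) (sd_inner l) etail r0 B0 IH' z _ mA3).
- by rewrite -[_ @^-1` _]setTI; exact: mphi.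
- move=> z1 Fz h0 _ rg tb; split; [exact: tb|rewrite /=].
  have same1 := same (phi z1) z1 (out z1).
  have hx : W_inner (params_of (phi z1)) l *m x = preact e j0 r z1.
    by rewrite block_inner bphi -mulmxA Hx -scalemxAr /preact colE.
  case: Fz => /=; rewrite hx ?(same1 _).2 ?(same1 _).1; first by rewrite h0 rg.
  rewrite (_ : (\matrix_(i, j) _) = block_mx e z1 *m H); last first.
    by rewrite -bphi; apply/matrixP => i j; rewrite !mxE.
  rewrite -[gate (preact e j0 r z1) _]/(bw z1) trmx_mul -mulmxA.
  rewrite nrm2_gate HS; apply: le_lt_trans.
  (* [bw] depends on column j0, so its nonnegative term is dropped to keep only columns independent
     of [bw]. *)
  rewrite (bigD1 j0 j0S) -[leLHS]add0r lerD ?sqr_ge0//.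
  rewrite /X big_enum/= le_eqVlt; apply/orP; left; apply/eqP.
  apply: eq_big => [j|j _]; first by rewrite finset.in_setD1 andbC.
  by rewrite coldot_mulmx.
move=> z1; apply: (@pr_backward _ e j0 ls r (@inner_inj l) egrad S'
  (fun z => [set z1 | X z1 (bw z) < tau (size ls).+1])) => //.
- by rewrite !inE eqxx.
- by move=> z2; exact: measurable_lt.
- by move=> z2 z3 _ [_ /= Xz3] _ bE; rewrite /bw bE.
- by move=> z2 [].
- move=> z2 tz2; apply: pr_chisq_tau => //; [exact: inner_inj|exact: sd_inner|].
  by move: mx; rewrite npos_card -/S (cardsD1 j0) j0S add1n.
Qed.

Variables (l3 a3 thr d3 : R).
Hypotheses (l30 : 0 <= l3) (a30 : 0 < a3) (d30 : 0 <= d3)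
  (d3E : expR (l3 * thr) * (expR (- (l3 / a3)) + expR 1 *
      (Num.sqrt (1 + 2 * a3 ^+ 2 * sg ^+ 2 * tau L.-1))^-1) ^+ d.-1 <= d3).

Definition bad_gradient (x : 'cV[R]_d) : set cube :=
  [set z | ~~ (nonzero (W_first (params_of z) *m x) &&
      regular (params_of z) (enum 'I_L.-1) (act (W_first (params_of z) *m x))) \/
    \sum_j `|input_gradient (params_of z) x j ord0| < thr].

Lemma measurable_bad_gradient x : measurable (bad_gradient x).
Proof.
have mh : measurable_vec (fun z : cube => W_first (params_of z) *m x).
  by apply: (measurable_mulmx (e := first_index)) => // z i j; rewrite mxE.
have mg : measurable_vec (fun z : cube => input_gradient (params_of z) x).
  apply: (measurable_mulmx (e := fun i j => first_index j i)).
    by move=> z i j; rewrite !mxE.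
  by apply: measurable_gate => //; apply: measurable_grad; exact: measurable_act.
rewrite (_ : bad_gradient x = ~` ([set z : cube | nonzero (W_first (params_of z) *m x)] `&`
  [set z : cube | regular (params_of z) (enum 'I_L.-1) (act (W_first (params_of z) *m x))]) `|`
  [set z : cube | \sum_j `|input_gradient (params_of z) x j ord0| < thr]).
  apply: measurableU.
    apply: measurableC; apply: measurableI; first exact: measurable_nonzero.
    by apply: measurable_regular; exact: measurable_act.
  apply: measurable_lt => //; apply: measurable_sum => j.
  by apply: measurableT_comp => //; exact: mg.
apply/seteqP; split => z /= [H|H]; try by right.
  by left => -[h1 h2]; rewrite h1 h2 in H.
by left; apply/negP => /andP[h1 h2]; apply: H.
Qed.

(** The base point is already a basis vector, so [pr_layer] applies with r = 1 and no rotation; [d3]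
    bounds the l^1 norm over the other columns. *)
Lemma pr_bad_gradient (j0 : 'I_d) z :
  (pr sd (block first_index ++ tail_coords (enum 'I_L.-1))
     (bad_gradient (delta_mx j0 ord0)) z
    <= (d1 + (d1 + d2) * L.-1.+1%:R + d3)%:E)%E.
Proof.
set ls := enum 'I_L.-1; set e := first_index.
have szls : size ls = L.-1 by rewrite size_enum_ord.
have etail i j : e i j \notin tail_coords ls.
  by apply/negP => /mem_tail_coords[[l' [i' [j' [l'ls]]]]|[i' [j']]].
have egrad (z1 z2 : cube) : agree (block e) z1 z2 -> forall y,
    grad (params_of z1) ls y = grad (params_of z2) ls y.
  move=> ag y1; apply: (eq_grad _ _ _).1 => [l _|].
    apply/matrixP => i j; rewrite !mxE; apply: ag.
    by apply/negP => /mem_blockP[i' [j']].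
  apply/matrixP => i j; rewrite !mxE; apply: ag.
  by apply/negP => /mem_blockP[i' [j']].
set B := (d1 + d2) * L.-1.+1%:R.
have B0 : 0 <= B by rewrite mulr_ge0// addr_ge0.
have IH' (x1 : 'cV[R]_N) : (forall j, 0 <= x1 j ord0) -> mm <= npos x1 -> forall z,
    (pr sd (tail_coords ls) (bad ls (tau (size ls)) (fun=> x1)) z <= B%:E)%E.
  have -> : B = (d1 + d2) * (size ls).+1%:R by rewrite szls.
  by move=> ? ? z1; apply: pr_bad => //; exact: enum_uniq.
pose bw := backward e j0 ls 1.
pose S' := (~: [set j0])%SET.
pose X (z : cube) (b : 'cV[R]_N) : R := \sum_(j <- enum S') `|coldot e (fun i => b i ord0) z j|.
have mX b : measurable_fun setT (fun z => X z b).
  by apply: measurable_sum => j; exact: measurable_coldot_abs.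
have mbw : measurable_vec bw by exact: measurable_backward.
have mXb : measurable_fun setT (fun z => X z (bw z)).
  apply: measurable_sum => j; apply: measurableT_comp => //; apply: measurable_sum => i.
  by apply: measurable_funM; [exact: mbw|exact: measurable_coord].
pose A3 : set cube := [set z | tau (size ls) <= nrm2 (bw z)] `&` [set z | X z (bw z) < thr].
have mA3 : measurable A3.
  apply: measurableI; last exact: measurable_lt.
  by apply: measurable_le => //; exact: measurable_nrm2.
apply: (pr_layer first_inj sd_first etail ltr01 B0 IH' z (measurable_bad_gradient _) mA3).
- move=> z1 Fz h0 _ rg tb; split; [exact: tb|rewrite /=].
  have WE : W_first (params_of z1) = block_mx e z1 by apply/matrixP => i j; rewrite !mxE.
  have hx : W_first (params_of z1) *m delta_mx j0 ord0 = preact e j0 1 z1.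
    by rewrite /preact scale1r colE WE.
  case: Fz; rewrite ?/input_gradient hx; first by rewrite h0 rg.
  apply: le_lt_trans; rewrite /X big_enum/= [leRHS](bigD1 j0)//=.
  rewrite -[leLHS]add0r lerD ?normr_ge0// le_eqVlt; apply/orP; left; apply/eqP.
  apply: eq_big => [j|j _]; first by rewrite !inE.
  by rewrite coldot_mulmx; congr `|(_^T *m _) j ord0|.
move=> z1; apply: (@pr_backward _ e j0 ls 1 first_inj egrad S'
  (fun z => [set z1 | X z1 (bw z) < thr])) => //.
- by rewrite !inE eqxx.
- by move=> z2; exact: measurable_lt.
- by move=> z2 z3 _ [_ /= Xz3] _ bE; rewrite /bw bE.
- by move=> z2 [].
move=> z2 tz2; apply: (le_trans (pr_l1 first_inj sd_first sg0 (fun i => bw z2 i ord0) thr z2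
  (enum_uniq _) l30 a30)).
rewrite lee_fin; apply: le_trans d3E; rewrite ler_wpM2l ?expR_ge0//.
rewrite -cardE cardsC1 card_ord; apply: lerXn2r.
- by rewrite nnegrE addr_ge0 ?expR_ge0// mulr_ge0 ?expR_ge0// invr_ge0 sqrtr_ge0.
- by rewrite nnegrE addr_ge0 ?expR_ge0// mulr_ge0 ?expR_ge0// invr_ge0 sqrtr_ge0.
rewrite lerD2l ler_wpM2l ?expR_ge0//.
have c0 : 0 <= 2 * a3 ^+ 2 * sg ^+ 2 by rewrite mulr_ge0 ?sqr_ge0// mulr_ge0 ?sqr_ge0.
have t0 := tau_gt0 L.-1.
rewrite szls in tz2.
have n0 : 0 <= nrm2 (bw z2) by apply: le_trans tz2; exact: ltW.
rewrite lef_pV2 ?posrE ?sqrtr_gt0.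
- by rewrite ler_wsqrtr// lerD2l ler_wpM2l.
- by rewrite ltr_pwDl// mulr_ge0.
- by rewrite ltr_pwDl// mulr_ge0// ltW.
Qed.

End recursion.

(** * Measurability of the event and choice of the constants *)

Section event.
Variables (R : realType) (d N L : nat).
Local Notation K := (param_index d N L).
Local Notation cube := (@cube R K).

Lemma measurable_relu_layer m n (e : 'I_m -> 'I_n -> K) (f : 'I_m -> K)
    (W : cube -> 'M[R]_(m, n)) (b : cube -> 'cV[R]_m) (x : cube -> 'cV[R]_n) :
  (forall z i j, W z i j = z (e i j)) -> (forall z i, b z i ord0 = z (f i)) ->
  measurable_vec x -> measurable_vec (fun z => relu_layer (W z) (b z) (x z)).
Proof.
move=> WE bE mx; apply: (measurable_act (h := fun z => W z *m x z + b z)) => i.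
rewrite (_ : (fun z => _) = (fun z => (W z *m x z) i ord0 + z (f i))); last first.
  by apply/funext => z; rewrite mxE bE.
apply: measurable_funD; last exact: measurable_coord.
exact: (measurable_mulmx WE mx).
Qed.

Lemma measurable_relu_net (x : 'cV[R]_d) :
  measurable_fun setT (fun z : cube => relu_net (params_of z) x).
Proof.
have hid (ls : seq 'I_L.-1) (y : cube -> 'cV[R]_N) : measurable_vec y ->
    measurable_vec (fun z : cube => foldl (fun y l =>
      relu_layer (W_inner (params_of z) l) (b_inner (params_of z) l) y) (y z) ls).
  elim: ls y => [|l ls IH] y my; first exact: my.
  apply: (IH (fun z => relu_layer (W_inner (params_of z) l) (b_inner (params_of z) l) (y z))).
  apply: (@measurable_relu_layer _ _ (@inner_index d N L l) (fun i => inr (inr (inl (l, i))))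
    (fun z => W_inner (params_of z) l) (fun z => b_inner (params_of z) l) y _ _ my).
    by move=> z i j; rewrite mxE.
  by move=> z i; rewrite mxE.
have m1 : measurable_vec (fun z : cube =>
    relu_layer (W_first (params_of z)) (b_first (params_of z)) x).
  apply: (@measurable_relu_layer _ _ (@first_index d N L) (fun i => inr (inl i))
    (fun z => W_first (params_of z)) (fun z => b_first (params_of z)) (fun=> x)).
  - by move=> z i j; rewrite mxE.
  - by move=> z i; rewrite mxE.
  - by move=> i; exact: measurable_cst.
rewrite (_ : (fun z => _) = (fun z : cube => (W_last (params_of z) *m
  foldl (fun y l => relu_layer (W_inner (params_of z) l) (b_inner (params_of z) l) y)
  (relu_layer (W_first (params_of z)) (b_first (params_of z)) x) (enum 'I_L.-1)) ord0 ord0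
  + z (inr (inr (inr tt))))); last first.
  by apply/funext => z; rewrite /relu_net mxE; congr (_ + _); rewrite mxE.
apply: measurable_funD; last exact: measurable_coord.
apply: (measurable_mulmx (e := @last_index d N L)); last exact: hid.
by move=> z i j; rewrite mxE.
Qed.

Lemma rat_approx n (x : 'cV[R]_n) (eps : R) : 0 < eps ->
  exists q : 'cV[rat]_n, maxnorm (map_mx ratr q - x) <= eps.
Proof.
move=> e0.
have H i : exists q : rat, `|ratr q - x i ord0| <= eps.
  have [|q] := @rat_in_itvoo R (x i ord0) (x i ord0 + eps); first by rewrite ltrDl.
  rewrite in_itv/= => /andP[q1 q2]; exists q.
  by rewrite ger0_norm ?subr_ge0 ?(ltW q1)// lerBlDl ltW.
have /choice[q qP] := H.
exists (\col_i q i); apply: maxnorm_le => [|i]; first exact: ltW.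
by rewrite !mxE.
Qed.

(* Only countably many pairs of points matter, whence measurability of the event. *)
Lemma lipschitz_const_ge_rat (f : 'cV[R]_d -> R) (a k : R) : 0 < a -> 0 <= k ->
  (forall x y, `|f x - f y| <= k * maxnorm (x - y)) ->
  (a%:E <= lipschitz_const +oo%E f)%E <->
  forall b : rat, 0 < (ratr b : R) < a -> exists q : 'cV[rat]_d * 'cV[rat]_d,
    (ratr b : R) * maxnorm (map_mx ratr q.1 - map_mx ratr q.2) <
      `|f (map_mx ratr q.1) - f (map_mx ratr q.2)|.
Proof.
move=> a0 k0 fk; split.
  move=> aL b /andP[b0 ba].
  have : ((ratr b)%:E < lipschitz_const +oo%E f)%E by apply: lt_le_trans aL.
  move=> /ereal_sup_gt[_ [[x y] /= xy <-]]; rewrite lte_fin.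
  have xy0 : x - y != 0 by rewrite subr_eq0.
  rewrite -[\big[Num.max/0]_(i < d) _]/(maxnorm (x - y)) ltr_pdivlMr ?maxnorm_gt0// => H.
  pose g := `|f x - f y| - ratr b * maxnorm (x - y).
  have g0 : 0 < g by rewrite subr_gt0.
  (* Moving both points by [eps] costs at most 2 k [eps] on one side and 2 b [eps] on the other,
     together half of the gap g. *)
  pose eps := g / (4 * (k + ratr b)).
  have kb : 0 < k + ratr b by rewrite ltr_wpDl.
  have e0 : 0 < eps by rewrite divr_gt0// mulr_gt0.
  have ge : g = 4 * (k * eps) + 4 * (ratr b * eps).
    by rewrite /eps; field; rewrite gt_eqF.
  have [q1 q1x] := rat_approx x e0; have [q2 q2y] := rat_approx y e0.
  exists (q1, q2) => /=; set u := map_mx ratr q1; set v := map_mx ratr q2.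
  rewrite -/u in q1x; rewrite -/v in q2y.
  have f1 : `|f u - f x| <= k * eps by apply: (le_trans (fk _ _)); rewrite ler_wpM2l.
  have f2 : `|f v - f y| <= k * eps by apply: (le_trans (fk _ _)); rewrite ler_wpM2l.
  have M : maxnorm (u - v) <= maxnorm (x - y) + 2 * eps.
    have -> : u - v = (x - y) + ((u - x) + (- (v - y))).
      by apply/matrixP => i j; rewrite !mxE; ring.
    apply: (le_trans (maxnormD _ _)); rewrite lerD2l; apply: (le_trans (maxnormD _ _)).
    by rewrite maxnormN mulr_natl mulr2n lerD.
  have F : `|f x - f y| <= `|f u - f v| + 2 * (k * eps).
    have -> : f x - f y = (f u - f v) + (- (f u - f x) + (f v - f y)) by ring.
    apply: (le_trans (ler_normD _ _)); rewrite lerD2l; apply: (le_trans (ler_normD _ _)).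
    by rewrite normrN mulr_natl mulr2n lerD.
  have Mb : ratr b * maxnorm (u - v) <= ratr b * maxnorm (x - y) + 2 * (ratr b * eps).
    apply: (@le_trans _ _ (ratr b * (maxnorm (x - y) + 2 * eps))).
      by rewrite ler_wpM2l// ltW.
    by rewrite mulrDr mulrCA.
  have ke0 : 0 <= k * eps by rewrite mulr_ge0// ltW.
  have be0 : 0 < ratr b * eps by rewrite mulr_gt0.
  rewrite /g in ge; lra.
move=> H; rewrite leNgt; apply/negP => La.
(* Taking r nonnegative makes every rational b strictly between r and a positive. *)
have [r [r0 ra Lr]] : exists r : R, [/\ 0 <= r, r < a & (lipschitz_const +oo%E f <= r%:E)%E].
  move: La; case: (lipschitz_const +oo%E f) => [r| |] //.
    rewrite lte_fin => ra; exists (Num.max r 0); split.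
    - by rewrite le_max lexx orbT.
    - by rewrite gt_max ra.
    - by rewrite lee_fin le_max lexx.
  by move=> _; exists 0; split => //; rewrite leNye.
have [b] := rat_in_itvoo ra; rewrite in_itv/= => /andP[rb ba].
have b0 : 0 < ratr b :> R by apply: le_lt_trans rb.
have [|[q1 q2] /= Hq] := H b; first by rewrite b0 ba.
set u := map_mx ratr q1 in Hq; set v := map_mx ratr q2 in Hq.
have uv : u != v.
  apply/eqP => uv; move: Hq; rewrite uv !subrr normr0.
  by rewrite ltNge mulr_ge0 ?maxnorm_ge0// ltW.
have : (((`|f u - f v| / lp_norm +oo%E (u - v))%:E) <= lipschitz_const +oo%E f)%E.
  by apply: ereal_sup_ubound; exists (u, v).
move=> /le_trans/(_ Lr); rewrite lee_fin -[lp_norm _ _]/(maxnorm (u - v)).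
have uv0 : 0 < maxnorm (u - v) by rewrite maxnorm_gt0// subr_eq0.
rewrite ler_pdivrMr// leNgt => /negP; apply.
by apply: lt_trans Hq; rewrite ltr_pM2r.
Qed.

Lemma measurable_lipschitz_ge (a : R) : 0 < a ->
  measurable [set z : cube | (a%:E <= lipschitz_const +oo%E (relu_net (params_of z)))%E].
Proof.
move=> a0.
pose A (b : rat) (q : 'cV[rat]_d * 'cV[rat]_d) : set cube :=
  [set z : cube | (ratr b : R) * maxnorm (map_mx ratr q.1 - map_mx ratr q.2 : 'cV[R]_d) <
     `|relu_net (params_of z) (map_mx ratr q.1) - relu_net (params_of z) (map_mx ratr q.2)|].
have mA b q : measurable (A b q).
  apply: measurable_lt => //; apply: measurableT_comp => //.
  by apply: measurable_funB; exact: measurable_relu_net.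
pose F (b : rat) : set cube := if 0 < (ratr b : R) < a then \bigcup_q A b q else setT.
have mF b : measurable (F b).
  rewrite /F; case: ifP => // _; apply: countable_bigcupT_measurable => //.
rewrite (_ : [set z : cube | _] = ~` \bigcup_b ~` F b).
  by apply: measurableC; apply: bigcupT_measurable_rat => b; exact: measurableC.
rewrite setC_bigcup; under eq_bigcapr do rewrite setCK.
apply/seteqP; split => z /=.
  have [k k0 fk] := lipschitz_relu_net (params_of z).
  move=> /(lipschitz_const_ge_rat a0 k0 fk) H b _; rewrite /F; case: ifP => // bb.
  by have [q Hq] := H b bb; exists q.
have [k k0 fk] := lipschitz_relu_net (params_of z).
move=> H; apply/(lipschitz_const_ge_rat a0 k0 fk) => b bb.
by have := H b I; rewrite /F bb => -[q _ Hq]; exists q.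
Qed.

End event.

(** * Numerical estimates *)

Section numerics.
Variable R : realType.

Lemma expRN_le (x : R) : 0 <= x -> expR (- x) <= 1 - x + x ^+ 2.
Proof.
move=> x0; have x1 : 0 < 1 + x by rewrite ltr_pwDl.
apply: (@le_trans _ _ (1 + x)^-1).
  by rewrite expRN lef_pV2 ?posrE ?expR_gt0// expR_ge1Dx.
rewrite -[leLHS]mul1r ler_pdivrMr//.
rewrite (_ : (1 - x + x ^+ 2) * (1 + x) = 1 + x ^+ 3); last by ring.
by rewrite lerDl exprn_ge0.
Qed.

(** Amounts to ln(1 + x) >= x - x^2, obtained from exp u >= 1 + u at u = x^2 - x. *)
Lemma invr_sqrt_le (x : R) : 0 <= x -> (Num.sqrt (1 + x))^-1 <= expR (- ((x - x ^+ 2) / 2)).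
Proof.
move=> x0; have x1 : 0 < 1 + x by rewrite ltr_pwDl.
rewrite expRN lef_pV2 ?posrE ?expR_gt0 ?sqrtr_gt0//.
rewrite -[leLHS]ger0_norm ?expR_ge0// -sqrtr_sqr ler_wsqrtr//.
rewrite expr2 -expRD -splitr.
have := expRN_le x0; have := expR_ge1Dx (- (x - x ^+ 2)); rewrite expRN => H _.
have H' : (1 + x)^-1 <= (expR (x - x ^+ 2))^-1.
  apply: le_trans H; rewrite -[leLHS]mul1r ler_pdivrMr//.
  rewrite (_ : (1 + - (x - x ^+ 2)) * (1 + x) = 1 + x ^+ 3); last by ring.
  by rewrite lerDl exprn_ge0.
by rewrite lef_pV2 ?posrE ?expR_gt0 in H'.
Qed.

(** The parameter k/2 minimizes the exponent N (l^2 - l k)/2 that remains after (1 + exp(-l))/2 <=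
    exp(-l/2 + l^2/2). *)
Lemma few_positive_bound (N : nat) (k : R) : 0 <= k ->
  expR (k / 2 * (N%:R / 2 * (1 - k))) * ((1 + expR (- (k / 2))) / 2) ^+ N
    <= expR (- (N%:R * k ^+ 2 / 8)).
Proof.
move=> k0; set l := k / 2; have l0 : 0 <= l by rewrite divr_ge0.
apply: (@le_trans _ _ (expR (l * (N%:R / 2 * (1 - k))) *
    expR (- (l / 2) + l ^+ 2 / 2) ^+ N)).
  rewrite ler_wpM2l ?expR_ge0// lerXn2r ?nnegrE ?expR_ge0//.
  apply: le_trans (expR_ge1Dx _); have := expRN_le l0; lra.
rewrite -expRM_natl -expRD ler_expR /l -mulr_natl le_eqVlt; apply/orP; left; apply/eqP.
by field.
Qed.

(** To second order the exponent is (N/4) y (y - eps/2), minimal at y = eps/4; the third-order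
    remainder has the favourable sign. *)
Lemma chisq_bound (N : nat) (eps : R) (k : nat) : 0 <= eps <= 1 ->
  N%:R / 2 * (1 - eps / 2) <= k%:R ->
  expR (eps / 4 * (N%:R / 4) * (1 - eps)) * (Num.sqrt (1 + eps / 4))^-1 ^+ k
    <= expR (- (N%:R * eps ^+ 2 / 64)).
Proof.
move=> /andP[e0 e1] Nk; set y := eps / 4; have y0 : 0 <= y by rewrite divr_ge0.
apply: (@le_trans _ _ (expR (y * (N%:R / 4) * (1 - eps)) *
   expR (- ((y - y ^+ 2) / 2)) ^+ k)).
  rewrite ler_wpM2l ?expR_ge0// lerXn2r ?nnegrE ?expR_ge0 ?invr_ge0 ?sqrtr_ge0//.
  exact: invr_sqrt_le.
rewrite -expRM_natl -expRD ler_expR -mulr_natl.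
have yy : 0 <= (y - y ^+ 2) / 2.
  by rewrite divr_ge0// subr_ge0 expr2 ler_piMl// /y; lra.
have := ler_wpM2r yy Nk.
have N0 : 0 <= N%:R * eps ^+ 3 :> R by rewrite mulr_ge0// exprn_ge0.
have -> : y = eps / 4 by [].
move=> H; rewrite mulrN lerBlDr -lerBlDl.
apply: le_trans _ H.
rewrite -subr_ge0.
rewrite (_ : _ - _ = N%:R * eps ^+ 3 / 128); first by rewrite divr_ge0.
by field.
Qed.

Lemma expR1_le4 : expR 1 <= 4 :> R.
Proof.
have := expR_ge1Dx (- (2^-1) : R).
have h : expR (- (2^-1)) * expR (- (2^-1)) = (expR 1)^-1 :> R.
  by rewrite -expRD -expRN; congr expR; lra.
move=> H; have : 4^-1 <= (expR 1)^-1 :> R.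
  rewrite -h (_ : 4^-1 = 2^-1 * 2^-1); last by lra.
  by apply: ler_pM; lra.
by rewrite lef_pV2 ?posrE ?expR_gt0.
Qed.

Lemma one_le_ln (x : R) : 4 <= x -> 1 <= ln x.
Proof.
move=> x4; rewrite -ler_expR lnK; first exact: le_trans expR1_le4 x4.
by rewrite posrE (lt_le_trans _ x4).
Qed.

(** The value 224 = 7 * 32 makes the first term exp(-7) <= 1/8, and a root of at least 32 makes the
    second at most 4/32. Their sum is below 1/e, while the threshold costs only exp(0.224 d). *)
Lemma l1_bound (d : nat) (V : R) : (5 <= d)%N -> 1 + 32 ^+ 2 <= V ->
  expR (224 * ((1 / 1000) * d%:R)) * (expR (- (224 / 32)) + expR 1 * (Num.sqrt V)^-1) ^+ d.-1
    <= expR (- (d%:R / 4)).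
Proof.
move=> d5 hV.
have e7 : expR (- (224 / 32)) <= 8^-1 :> R.
  rewrite expRN lef_pV2 ?posrE ?expR_gt0//; apply: le_trans (expR_ge1Dx _); lra.
have sV : (Num.sqrt V)^-1 <= 32^-1.
  have V0 : 0 < V by apply: lt_le_trans hV; rewrite ltr_pwDl// exprn_ge0.
  rewrite lef_pV2 ?posrE ?sqrtr_gt0//.
  rewrite -[leLHS]ger0_norm// -sqrtr_sqr ler_wsqrtr//.
  by apply: le_trans hV; rewrite lerDr.
have e4 := expR1_le4.
have s0 : 0 <= (Num.sqrt V)^-1 by rewrite invr_ge0 sqrtr_ge0.
have m4 : expR (- (224 / 32)) + expR 1 * (Num.sqrt V)^-1 <= expR (- 1).
  apply: (@le_trans _ _ 4^-1); last by rewrite expRN lef_pV2 ?posrE ?expR_gt0.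
  have : expR 1 * (Num.sqrt V)^-1 <= 4 * 32^-1 by apply: ler_pM; rewrite ?expR_ge0.
  lra.
apply: (@le_trans _ _ (expR (224 * ((1 / 1000) * d%:R)) * expR (- 1) ^+ d.-1)).
  rewrite ler_wpM2l ?expR_ge0// lerXn2r ?nnegrE ?expR_ge0//.
rewrite -expRM_natl -expRD ler_expR.
have -> : (d.-1%:R : R) = d%:R - 1 by case: d d5 => // n _; rewrite -natr1 addrK.
have : 5 <= d%:R :> R by rewrite (ler_nat R 5).
by lra.
Qed.

(** The exponent of one layer is at least 8 d L, which absorbs the factor 3 L <= exp(3 L) of the
    union bound. The final factor 2 <= e is paid by d/4 - d/1000 >= 1. *)
Lemma total_bound (d N L : nat) : (0 < L)%N -> (5 <= d)%N ->
  8 ^+ 4 * d%:R * L%:R ^+ 4 <= N%:R :> R ->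
  expR (- (N%:R / (8 ^+ 3 * L%:R ^+ 2))) +
   (expR (- (N%:R / (8 ^+ 3 * L%:R ^+ 2))) + expR (- (N%:R / (8 ^+ 3 * L%:R ^+ 2)))) * L%:R +
   expR (- (d%:R / 4)) <= expR (- (1 / 1000 * d%:R)) :> R.
Proof.
move=> L0 d5 HN; set de := expR (- (_ / _)).
have L1 : 1 <= L%:R :> R by rewrite ler1n.
have D5 : 5 <= d%:R :> R by rewrite (ler_nat R 5).
have LL : 0 < 8 ^+ 3 * L%:R ^+ 2 :> R by apply: mulr_gt0; apply: exprn_gt0; [rewrite ltr0n|exact: lt_le_trans L1].
have h1 : 8 * d%:R * L%:R <= N%:R / (8 ^+ 3 * L%:R ^+ 2) :> R.
  rewrite ler_pdivlMr//; apply: le_trans HN.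
  rewrite (_ : 8 * d%:R * L%:R * (8 ^+ 3 * L%:R ^+ 2) = 8 ^+ 4 * d%:R * L%:R ^+ 3); last by ring.
  apply: ler_wpM2l; first by rewrite mulr_ge0 ?exprn_ge0 ?ler0n.
  exact: ler_weXn2l.
have de1 : de <= expR (- (8 * d%:R * L%:R)) by rewrite ler_expR lerN2.
have de0 : 0 <= de by exact: expR_ge0.
have eL : 3 * L%:R <= expR (3 * L%:R) :> R.
  by apply: le_trans (expR_ge1Dx _); rewrite lerDr.
have h2 : de + (de + de) * L%:R <= expR (- (d%:R / 4)).
  apply: (@le_trans _ _ (3 * L%:R * de)).
    have : de * 1 <= de * L%:R by rewrite ler_wpM2l.
    lra.
  apply: (@le_trans _ _ (expR (3 * L%:R) * expR (- (8 * d%:R * L%:R)))).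
    by apply: ler_pM => //; rewrite mulr_ge0.
  rewrite -expRD ler_expR.
  have : d%:R * 1 <= d%:R * L%:R :> R by rewrite ler_wpM2l.
  have : 5 * L%:R <= d%:R * L%:R :> R by rewrite ler_wpM2r.
  rewrite -!mulrA; lra.
apply: (@le_trans _ _ (2 * expR (- (d%:R / 4)))); first lra.
apply: (@le_trans _ _ (expR 1 * expR (- (d%:R / 4)))).
  rewrite ler_wpM2r ?expR_ge0//; apply: le_trans (expR_ge1Dx _); lra.
rewrite -expRD ler_expR; lra.
Qed.

End numerics.

(** * Choice of the parameters *)

Section law_of_parameters.
Variable R : realType.

Lemma bernoulli_ineq (e : R) n : 0 <= e <= 1 -> 1 - n%:R * e <= (1 - e) ^+ n.
Proof.
move=> /andP[e0 e1]; elim: n => [|n IH]; first by rewrite mul0r subr0.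
have e1' : 0 <= 1 - e by rewrite subr_ge0.
rewrite exprS; apply: le_trans (ler_wpM2l e1' IH).
have : 0 <= n%:R * e * e by rewrite !mulr_ge0.
rewrite -natr1; lra.
Qed.

Definition param_sd (d N L : nat) (s : R) (k : param_index d N L) : R :=
  match k with
  | inl (inl _) => s
  | inl (inr (inl _)) => s
  | _ => 1
  end.

Lemma pr_gradient_small (d N L : nat) (j0 : 'I_d) (z : @cube R (param_index d N L)) :
  (0 < N)%N -> (0 < L)%N -> (5 <= d)%N ->
  8 ^+ 4 * d%:R * L%:R ^+ 4 <= N%:R :> R ->
  (pr (param_sd (Num.sqrt (2 / N%:R)))
     (block (@first_index d N L) ++ @tail_coords d N L (enum 'I_L.-1))
     (@bad_gradient R d N L (1 / 1000 * d%:R) (delta_mx j0 ord0)) z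
    <= (expR (- (1 / 1000 * d%:R)))%:E)%E.
Proof.
move=> N0 L0 d5 HN.
have Nr : 0 < N%:R :> R by rewrite ltr0n.
have Lr : 1 <= L%:R :> R by rewrite ler1n.
have Lp : 0 < L%:R :> R by rewrite ltr0n.
have Ln : L%:R != 0 :> R by rewrite gt_eqF.
have dr : 5 <= d%:R :> R by rewrite (ler_nat R 5).
set s := Num.sqrt (2 / N%:R).
have s20 : 0 < 2 / N%:R :> R by rewrite divr_gt0.
have s0 : s != 0 by rewrite gt_eqF// sqrtr_gt0.
have s2 : s ^+ 2 = 2 / N%:R by rewrite sqr_sqrtr// ltW.
(* By Bernoulli's inequality (1 - [eps])^L >= 1/2. Since [kap] = [eps]/4, the lost column j0 can be
   charged to a second [kap], leaving the factor 1 - [eps]/2 required by [chisq_bound]. *)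
pose kap : R := (8 * L%:R)^-1; pose eps : R := (2 * L%:R)^-1.
have kap0 : 0 < kap by rewrite invr_gt0 mulr_gt0.
have eps0 : 0 < eps by rewrite invr_gt0 mulr_gt0.
have ek : eps = 4 * kap by rewrite /eps /kap; field.
have eps1 : eps <= 2^-1 by rewrite /eps lef_pV2 ?posrE ?mulr_gt0//; lra.
have NL : 16 * L%:R <= N%:R :> R.
  apply: le_trans HN; rewrite -[16 * _]mulr1.
  have L4 : L%:R * 1 <= L%:R ^+ 4 :> R.
    by rewrite [X in _ <= X]exprS ler_wpM2l ?ler0n// exprn_ege1.
  have : 8 ^+ 4 * L%:R <= 8 ^+ 4 * d%:R * L%:R ^+ 4 :> R.
    by apply: ler_pM; rewrite ?ler0n ?exprn_ge0//; lra.
  lra.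
(* This pays for the off-by-one in [d2E]: one column is at most a fraction [kap] of N/2. *)
have Nk : 1 <= N%:R / 2 * kap by rewrite /kap -mulrA -invfM ler_pdivlMr ?mulr_gt0//; lra.
pose mm : R := N%:R / 2 * (1 - kap).
have mm0 : 0 < mm by rewrite mulr_gt0// ?divr_gt0// subr_gt0; lra.
pose de := expR (- (N%:R / (8 ^+ 3 * L%:R ^+ 2))) : R.
have d1E : expR (kap / 2 * mm) * ((1 + expR (- (kap / 2))) / 2) ^+ N <= de.
  apply: le_trans (few_positive_bound N (ltW kap0)) _.
  by rewrite ler_expR le_eqVlt; apply/orP; left; apply/eqP; rewrite /kap; field.
have d2E (k : nat) : mm <= k.+1%:R ->
    expR (eps / 4 * (N%:R / 4) * (1 - eps)) * (Num.sqrt (1 + eps / 4))^-1 ^+ k <= de.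
  move=> mk; apply: le_trans (chisq_bound (N := N) (k := k) _ _) _.
  - by rewrite ltW//=; lra.
  - by move: mk; rewrite /mm -[k.+1]addn1 natrD ek; lra.
  rewrite ler_expR lerN2 ler_pdivrMr ?mulr_gt0 ?exprn_gt0//.
  rewrite (_ : _ / 64 * _ = 2 * N%:R); last by rewrite /eps; field.
  by rewrite ler_peMl ?ler0n//; lra.
(* The factors 2/N and N/2 cancel, leaving 32^2 times 2 (1 - [eps])^L >= 1. *)
have tauE : 32 ^+ 2 <= 2 * 32 ^+ 2 * s ^+ 2 * tau N (1 - eps) L.-1.
  rewrite /tau prednK// s2.
  rewrite (_ : 2 * 32 ^+ 2 * _ * _ = 32 ^+ 2 * (2 * (1 - eps) ^+ L)); last first.
    by field; rewrite gt_eqF.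
  rewrite ler_peMr ?exprn_ge0//.
  have : 0 <= eps <= 1 by rewrite ltW//=; lra.
  move=> /(bernoulli_ineq L); have -> : L%:R * eps = 2^-1 by rewrite /eps; field.
  lra.
have kap20 : 0 <= kap / 2 by rewrite divr_ge0// ltW.
have eps40 : 0 <= eps / 4 by rewrite divr_ge0// ltW.
have rho0 : 0 < 1 - eps by rewrite subr_gt0; lra.
have de0 : 0 <= de by exact: expR_ge0.
have V32 : 1 + 32 ^+ 2 <= 1 + 2 * 32 ^+ 2 * s ^+ 2 * tau N (1 - eps) L.-1.
  by rewrite lerD2l.
have d3E := l1_bound d5 V32.
have l30 : 0 <= 224 :> R by [].
have a30 : 0 < 32 :> R by [].
apply: le_trans (pr_bad_gradient (sd := param_sd s) s0 (fun _ _ _ => erefl) (fun _ _ => erefl)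
  (fun _ _ => erefl) mm0 kap20 eps40 rho0 N0 de0 de0 s2 d1E d2E l30 a30 (expR_ge0 _) d3E j0 z) _.
by rewrite lee_fin prednK//; exact: total_bound.
Qed.

End law_of_parameters.

Theorem theorem6p7 (R : realType) :
  exists C c : R, 0 < C /\ 0 < c /\
    forall (d N L : nat), (0 < d)%N -> (0 < N)%N -> (0 < L)%N ->
    forall (disp : measure_display) (T : measurableType disp)
      (P : probability T R) (Z : param_index d N L -> {RV P >-> R}),
    random_params Z ->
    C * (d%:R * L%:R) <= N%:R ->
    C * d%:R * L%:R ^+ 4 * (ln (N%:R / d%:R)) ^+ 2
      * (ln (N%:R / (d%:R * L%:R))) ^+ 2 <= N%:R ->
    C <= d%:R ->
    with_probability_ge P
      [set t | forall p : \bar R, (2%:E <= p)%E ->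
        ((c * d%:R `^ (1 - fine p^-1%E))%:E
           <= lipschitz_const p (random_relu_net Z t))%E]
      (1 - expR (- (c * d%:R))).
Proof.
(* 8^4 makes N / (8^3 L^2) at least 8 d L; 1/1000 is the threshold per coordinate in [l1_bound]. *)
exists (8 ^+ 4), (1 / 1000); split; first exact: exprn_gt0.
split; first by lra.
move=> d N L d0 N0 L0 disp T P Z [indep law1 law2 law3] HN1 HN2 Hd.
have Nr : 0 < N%:R :> R by rewrite ltr0n.
have Lr : 1 <= L%:R :> R by rewrite ler1n.
have Lp : 0 < L%:R :> R by rewrite ltr0n.
have dr : 0 < d%:R :> R by rewrite ltr0n.
have c84 : 5 <= 8 ^+ 4 :> R by lra.
have d5 : (5 <= d)%N by rewrite -(ler_nat R); exact: le_trans Hd.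
(* By the first hypothesis both quotients are at least 4, so both logarithms are at least 1. *)
have HN : 8 ^+ 4 * d%:R * L%:R ^+ 4 <= N%:R :> R.
  apply: le_trans HN2.
  have dL : 0 < d%:R * L%:R :> R by rewrite mulr_gt0.
  have q1 : 1 <= ln (N%:R / (d%:R * L%:R)) :> R.
    apply: one_le_ln; rewrite ler_pdivlMr//; apply: le_trans HN1.
    by rewrite ler_wpM2r ?(ltW dL)//; lra.
  have q2 : 1 <= ln (N%:R / d%:R) :> R.
    apply: one_le_ln; rewrite ler_pdivlMr//; apply: le_trans HN1.
    by apply: ler_pM; rewrite ?(ltW dr)//; [lra|rewrite ler_peMr// ltW].
  have X0 : 0 <= 8 ^+ 4 * d%:R * L%:R ^+ 4 :> R by rewrite !mulr_ge0 ?exprn_ge0 ?ler0n.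
  rewrite -[leRHS]mulrA; apply: ler_peMr => //.
  by apply: mulr_ege1; apply: exprn_ege1.
pose sd := @param_sd R d N L (Num.sqrt (2 / N%:R)).
pose Zt (t : T) : @cube R (param_index d N L) := fun k => Z k t.
have mZ := measurable_joint Z.
pose c : R := 1 / 1000.
have c0 : 0 < c by rewrite /c; lra.
have cd0 : 0 < c * d%:R by exact: mulr_gt0.
pose E : set (@cube R (param_index d N L)) :=
  [set z | ((c * d%:R)%:E <= lipschitz_const +oo%E (relu_net (params_of z)))%E].
have mE : measurable E by exact: measurable_lipschitz_ge.
pose j0 : 'I_d := Ordinal d0.
pose B := @bad_gradient R d N L (c * d%:R) (delta_mx j0 ord0).
have mB : measurable B by exact: measurable_bad_gradient.
have mZE : measurable (Zt @^-1` E) by have := mZ measurableT _ mE; rewrite setTI.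
have mZB : measurable (Zt @^-1` B) by have := mZ measurableT _ mB; rewrite setTI.
(* At p = +oo the exponent is 1, and this case implies all others, so the event for all p reduces to
   one measurable set. *)
rewrite (_ : [set t | _] = Zt @^-1` E); last first.
  apply/seteqP; split => t /= H.
    by have := H +oo%E (leey _); rewrite invey/= subr0 powRr1.
  exact: lipschitz_const_oo_all.
split => //.
have law (i : param_index d N L) :
    i \in block (@first_index d N L) ++ @tail_coords d N L (enum 'I_L.-1) ->
    forall A : set R, measurable A -> distribution P (Z i) A = normal_prob 0 (sd i) A.
  rewrite mem_cat => /orP[/mem_blockP[i1 [i2 ->]]|].
    by move=> A mA; exact: law1.
  move=> /mem_tail_coords[[l [i1 [i2 [_ ->]]]]|[i1 [i2 ->]]] A mA; first exact: law2.
  by rewrite (law3 i2 A mA) sqrtr1.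
have PB : (P (Zt @^-1` B) <= (expR (- (c * d%:R)))%:E)%E.
  apply: (probability_joint_le indep law mB) => z; exact: pr_gradient_small.
have BE : ~` (Zt @^-1` B) `<=` Zt @^-1` E.
  move=> t /= nB; rewrite /E/=.
  have [h0|h0] := boolP (nonzero (W_first (params_of (Zt t)) *m delta_mx j0 ord0) &&
    regular (params_of (Zt t)) (enum 'I_L.-1)
      (act (W_first (params_of (Zt t)) *m delta_mx j0 ord0))); last first.
    by case: nB; left.
  have [g|g] := ltP (\sum_j `|input_gradient (params_of (Zt t)) (delta_mx j0 ord0) j ord0|)
    (c * d%:R); first by case: nB; right.
  have /andP[h1 h2] := h0.
  apply: le_trans (lipschitz_ge_gradient d0 h1 h2); by rewrite lee_fin.
apply: le_trans (le_measure P _ _ BE); rewrite ?inE//; last exact: measurableC.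
apply: (@le_trans _ _ (1 - P (Zt @^-1` B))%E); first by rewrite EFinB; apply: leeB.
by rewrite le_eqVlt -(@probability_setC _ _ _ P _ mZB) eqxx.
Qed.
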